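(* Let the system $(A,B,C,D)$ be externally symmetric with signature matrix $\Sigma_e$, let $Q\succeq 0$, $R\succ 0$, $t_f\in(0,\infty)$, $x_0\in\mathbb{R}^n$ and $u_0\in\mathcal{L}_2^m(0,t_f)$. Let $$\bar\alpha=\frac{2}{\Vert R^{1/2}\mathcal{S}R^{-1/2}\Vert_{2,t_f}^2+1}$$ and let $\alpha\in\bigl(0,\min\{\bar\alpha,1\}\bigr)$. Then the sequence generated by $$u_{k+1}=(1-\alpha)u_k+\alpha\,\mathcal{T}(u_k),\qquad k=0,1,2,\dots$$ converges in $\mathcal{L}_2^m(0,t_f)$ to the optimal solution $u^\star$ of the problem of minimizing $J(x_0,u)$ over $u\in\mathcal{L}_2^m(0,t_f)$, i.e. $\lim_{k\to\infty}\Vert u_k-u^\star\Vert_{2,t_f}=0$.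
   Context: A prime denotes transpose. The system is $\frac{d}{dt}x(t)=Ax(t)+Bu(t)$, $y(t)=Cx(t)+Du(t)$, $t\ge 0$, with $x(t)\in\mathbb{R}^n$, $u(t),y(t)\in\mathbb{R}^m$ and real matrices $A,B,C,D$ of matching sizes. Its transfer function is $G(s)=C(sI-A)^{-1}B+D$. A signature matrix is a diagonal matrix with diagonal entries in $\{-1,+1\}$. The system is externally symmetric with signature matrix $\Sigma_e\in\mathbb{R}^{m\times m}$ if $\Sigma_e G(s)'=G(s)\Sigma_e$. The cost is $J(x_0,u)=\frac12\int_0^{t_f} y'(t)Qy(t)+u'(t)Ru(t)\,dt$, where $x,u,y$ satisfy the system equations with $x(0)=x_0$; here $Q,R\in\mathbb{R}^{m\times m}$ are symmetric. $\mathcal{L}_2^m(0,t_f)$ is the space of (classes of a.e. equal) measurable $u:[0,t_f]\to\mathbb{R}^m$ with $\Vert u\Vert_{2,t_f}=(\int_0^{t_f}\Vert u(t)\Vert_2^2dt)^{1/2}<\infty$; $\Vert\mathcal{K}\Vert_{2,t_f}$ also denotes the induced norm of a bounded linear operator $\mathcal{K}$ on this space. Define $\mathcal{J}u(t)=u(t_f-t)$, $\mathcal{G}u(t)=\int_0^t C\exp(A(t-\tau))Bu(\tau)\,d\tau+Du(t)$ for $t\in[0,t_f]$, and $d_{x_0}(t)=C\exp(At)x_0$. Matrices act pointwise on signals. Define $$\mathcal{T}(u)=-R^{-1}\Sigma_e\mathcal{J}\mathcal{G}\Sigma_eQ\mathcal{J}(\mathcal{G}u+d_{x_0}),\qquad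 \mathcal{S}=-R^{-1}\Sigma_e\mathcal{J}\mathcal{G}\Sigma_eQ\mathcal{J}\mathcal{G}.$$ $R^{1/2}$ is the principal square root of $R$. *)

(* Defs.v *)
From HB Require Import structures.
From mathcomp Require Import all_boot all_order all_algebra.
From mathcomp Require Import all_classical all_reals all_analysis.
From mathcomp Require Import complex.

Set Implicit Arguments.
Unset Strict Implicit.
Unset Printing Implicit Defensive.

Import Order.TTheory GRing.Theory Num.Theory.
Import numFieldNormedType.Exports.

Local Open Scope classical_set_scope.
Local Open Scope ring_scope.

Section Matrices.
Context (R : realType).

Definition signature_mx m (S : 'M[R]_m) : Prop :=
  is_diag_mx S /\ forall i, S i i = 1 \/ S i i = -1.

Definition posdef m (M : 'M[R]_m) : Prop :=
  M^T = M /\ forall v : 'cV[R]_m, v != 0 -> 0 < (v^T *m M *m v) 0 0.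

Definition possemidef m (M : 'M[R]_m) : Prop :=
  M^T = M /\ forall v : 'cV[R]_m, 0 <= (v^T *m M *m v) 0 0.

(* The principal square root of M: the unique symmetric positive semidefinite
   matrix whose square is M, when M is symmetric positive semidefinite (junk
   value 0 if there is no such root). *)
Definition sqrtmx m (M : 'M[R]_m) : 'M[R]_m :=
  xget 0 [set S : 'M[R]_m | possemidef S /\ S *m S = M].

(* exp M = sum_k M^k / k!, the limit being taken entrywise. *)
Definition expmx n (M : 'M[R]_n) : 'M[R]_n :=
  \matrix_(i, j)
    limn (fun N => \sum_(0 <= k < N) (k`!%:R^-1 *: M ^+ k) i j).

Definition enorm m (v : 'cV[R]_m) : R := Num.sqrt (\sum_i v i 0 ^+ 2).

Definition cmx m n (M : 'M[R]_(m, n)) : 'M[R[i]]_(m, n) :=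
  map_mx (real_complex R) M.

(* Only meaningful when s%:M - A is invertible. *)
Definition transfer n m (A : 'M[R]_n) (B : 'M[R]_(n, m)) (C : 'M[R]_(m, n))
    (D : 'M[R]_m) (s : R[i]) : 'M[R[i]]_m :=
  cmx C *m invmx (s%:M - cmx A) *m cmx B + cmx D.

Definition externally_symmetric n m (A : 'M[R]_n) (B : 'M[R]_(n, m))
    (C : 'M[R]_(m, n)) (D S : 'M[R]_m) : Prop :=
  forall s : R[i], s%:M - cmx A \in unitmx ->
    cmx S *m (transfer A B C D s)^T = transfer A B C D s *m cmx S.

End Matrices.

(* An element of L_2^m(0,tf) is represented by a function on the whole line
   of which only the values on [0,tf] matter; the classes of the space are the
   classes of [sig_ae]. *)
Section Signals.
Context (R : realType) (tf : R).

Definition sig_measurable m (u : R -> 'cV[R]_m) : Prop :=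
  forall i, measurable_fun `[0, tf] (fun t => u t i 0).

Definition sig_ae m (u v : R -> 'cV[R]_m) : Prop :=
  \forall t \ae @lebesgue_measure R, 0 <= t <= tf -> u t = v t.

Definition L2 m (u : R -> 'cV[R]_m) : Prop :=
  sig_measurable u /\
  (\int[@lebesgue_measure R]_(t in `[0%R, tf]) ((enorm (u t)) ^+ 2)%R%:E < +oo)%E.

Definition L2norm m (u : R -> 'cV[R]_m) : R :=
  Num.sqrt (\int[@lebesgue_measure R]_(t in `[0, tf]) (enorm (u t)) ^+ 2).

(* The norm induced on operators by L2norm. The supremum is the one of a real
   set, so this is meaningful for bounded operators. *)
Definition opnorm m (K : (R -> 'cV[R]_m) -> (R -> 'cV[R]_m)) : R :=
  sup [set L2norm (K u) | u in [set u | L2 u /\ L2norm u <= 1]].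

Definition cvg_L2 m (u : nat -> R -> 'cV[R]_m) (v : R -> 'cV[R]_m) : Prop :=
  [/\ forall k, L2 (u k), L2 v &
      (fun k => L2norm (fun t => u k t - v t)) @ \oo --> (0 : R)].

Definition vint m (a b : R) (f : R -> 'cV[R]_m) : 'cV[R]_m :=
  \col_i \int[@lebesgue_measure R]_(t in `[a, b]) f t i 0.

Definition mxact m p (M : 'M[R]_(m, p)) (u : R -> 'cV[R]_p) : R -> 'cV[R]_m :=
  fun t => M *m u t.

Definition reversal m (u : R -> 'cV[R]_m) : R -> 'cV[R]_m :=
  fun t => u (tf - t).

End Signals.

Section Problem.
Context (R : realType) (n m : nat).
Context (A : 'M[R]_n) (B : 'M[R]_(n, m)) (C : 'M[R]_(m, n)) (D : 'M[R]_m).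
Context (Sig Q Rw : 'M[R]_m) (tf : R) (x0 : 'cV[R]_n).

(* Since u is only square integrable, x' = A x + B u, x(0) = x0 is meant in
   the sense of Caratheodory: x is continuous and solves the integrated
   equation, so that it is absolutely continuous and solves the differential
   equation almost everywhere. *)
Definition is_state (u : R -> 'cV[R]_m) (x : R -> 'cV[R]_n) : Prop :=
  (forall i, {within `[0, tf], continuous (fun t => x t i 0)}) /\
  (forall t, 0 <= t <= tf ->
     x t = x0 + vint 0 t (fun tau => A *m x tau + B *m u tau)).

Definition output (x : R -> 'cV[R]_n) (u : R -> 'cV[R]_m) : R -> 'cV[R]_m :=
  fun t => C *m x t + D *m u t.

Definition cost_along (y u : R -> 'cV[R]_m) : R :=
  2^-1 * \int[@lebesgue_measure R]_(t in `[0, tf])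
    (((y t)^T *m Q *m y t) 0 0 + ((u t)^T *m Rw *m u t) 0 0).

(* The cost J(x0,u): the value of the cost along the state trajectory driven
   by u, which is unique on [0,tf]. *)
Definition cost (u : R -> 'cV[R]_m) : R :=
  xget 0 [set c | exists2 x, is_state u x & c = cost_along (output x u) u].

Definition optimal (u : R -> 'cV[R]_m) : Prop :=
  L2 tf u /\ forall v : R -> 'cV[R]_m, L2 tf v -> cost u <= cost v.

Definition Gop (u : R -> 'cV[R]_m) : R -> 'cV[R]_m :=
  fun t => vint 0 t (fun tau => C *m expmx ((t - tau) *: A) *m B *m u tau)
           + D *m u t.

Definition free_response : R -> 'cV[R]_m :=
  fun t => C *m expmx (t *: A) *m x0.

(* - R^{-1} Sigma J G Sigma Q J *)
Definition feedback (y : R -> 'cV[R]_m) : R -> 'cV[R]_m :=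
  mxact (- (invmx Rw *m Sig))
    (reversal tf (Gop (mxact (Sig *m Q) (reversal tf y)))).

Definition Top (u : R -> 'cV[R]_m) : R -> 'cV[R]_m :=
  feedback (fun t => Gop u t + free_response t).

Definition Sop (u : R -> 'cV[R]_m) : R -> 'cV[R]_m := feedback (Gop u).

Definition alphabar : R :=
  2 / (opnorm tf (fun u : R -> 'cV[R]_m =>
         mxact (sqrtmx Rw) (Sop (mxact (invmx (sqrtmx Rw)) u))) ^+ 2 + 1).

Definition relaxed_step (alpha : R) (u : R -> 'cV[R]_m) : R -> 'cV[R]_m :=
  fun t => (1 - alpha) *: u t + alpha *: Top u t.

End Problem.

(* Main.v *)
Require Import Defs.
From HB Require Import structures.
From mathcomp Require Import all_boot all_order all_algebra.
From mathcomp Require Import all_classical all_reals all_analysis.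
From mathcomp Require Import measurable_realfun spectral sesquilinear complex.
From mathcomp Require Import ring lra.

(** Write G* for the adjoint of the input-output map G on L2(0, tf), and d for
    the free response. External symmetry is a statement about the transfer
    function; expanding it at infinity shows that Sig conjugates D and every
    Markov parameter C A^k B into its transpose ([external_symmetry_markov]),
    hence also the impulse response ([impulse_response_symmetric]). Since
    taking the adjoint of a convolution transposes and time-reverses its
    kernel, G* = Sig J G J Sig, so that T and S are
      T u = - R^-1 G* Q (G u + d),   S = - R^-1 G* Q G
    ([feedback_Gadj]).

    The gradient of the cost at u is R u + G* Q (G u + d) = R (u - T u). As the
    cost is quadratic with the strictly convex term u' R u, a fixed point of T
    is the unique minimizer ([fixed_point_optimal]).

    The relaxed step has linear part (1 - alpha) + alpha S. Conjugated by
    R^1/2, S becomes K = - N* Q N with N = G R^-1/2, which is negative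
    semidefinite. So for 0 < alpha < 1 the cross term in the square of
    (1 - alpha) w + alpha K w only helps, and with nu the norm of K
      |(1 - alpha) w + alpha K w|^2 <= ((1 - alpha)^2 + alpha^2 nu^2) |w|^2,
    where the factor is below 1 exactly when alpha < 2 / (nu^2 + 1)
    ([relax_contract]). The iteration is thus a contraction in the norm of
    R^1/2 u, which is equivalent to the L2 norm. Completeness of L2
    ([L2_complete]) gives a limit, which is a fixed point of T
    ([relaxation_cvg_fixed_point]).

    The remaining ingredients connect these operators with their definitions:
    the matrix exponential is a one-parameter group, so the kernel of G
    separates and G is bounded with an explicit adjoint ([ip_Gop], by Fubini on
    a triangle); the state equation has exactly one solution, given by
    variation of constants ([is_state_unique]), so that the cost is the expected
    quadratic functional ([cost_formula]); and a positive semidefinite matrix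
    has a positive semidefinite root ([sqrtmxP]). *)

Set Implicit Arguments.
Unset Strict Implicit.
Unset Printing Implicit Defensive.

Import Order.TTheory GRing.Theory Num.Theory.
Import numFieldNormedType.Exports.

Local Open Scope classical_set_scope.
Local Open Scope ring_scope.

(** * The principal square root of a positive semidefinite matrix *)

Lemma interpolation (K : fieldType) (f : K -> K) (s : seq K) :
  exists p : {poly K}, forall x, x \in s -> p.[x] = f x.
Proof.
elim: s => [|a s [p hp]]; first by exists 0.
have [as_|as_] := boolP (a \in s).
  by exists p => x; rewrite inE => /predU1P[->|]; exact: hp.
pose q : {poly K} := \prod_(b <- s) ('X - b%:P).
have qa : q.[a] != 0 by rewrite -[_ == 0]/(root q a) root_prod_XsubC.
exists (p + ((f a - p.[a]) / q.[a]) *: q) => x.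
rewrite inE hornerD hornerZ => /predU1P[->|xs]; first by field.
have /eqP -> : q.[x] == 0 by rewrite -[_ == 0]/(root q x) root_prod_XsubC.
by rewrite mulr0 addr0 hp.
Qed.

Section MatrixSqrt.
Context (R : realType).

Lemma cmx_inj m n : injective (@cmx R m n).
Proof.
move=> M N /matrixP MN; apply/matrixP => i j.
by have := MN i j; rewrite !mxE => /complexI.
Qed.

Lemma psd_eigenvalue_ge0 m (M : 'M[R]_m) a :
  possemidef M -> eigenvalue M a -> 0 <= a.
Proof.
move=> [_ Mpos] /eigenvalueP[v vM v0].
have := Mpos v^T; rewrite trmxK vM -scalemxAl mxE.
have vv : 0 < (v *m v^T) 0 0.
  rewrite lt_def; apply/andP; split; last first.
    by rewrite mxE; apply: sumr_ge0 => i _; rewrite mxE -expr2 sqr_ge0.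
  apply: contra v0; rewrite mxE psumr_eq0 => [/allP vi|i _]; last first.
    by rewrite mxE -expr2 sqr_ge0.
  apply/eqP/rowP => i; have := vi i (mem_index_enum _).
  by rewrite !mxE mulf_eq0 orbb => /eqP.
by rewrite pmulr_lge0.
Qed.

(** Over the complex numbers M is unitarily diagonalizable with real
    eigenvalues, so a real polynomial in M vanishes as soon as it vanishes on
    the list s of those eigenvalues. *)
Lemma symmetric_annihilated m (M : 'M[R]_m.+1) :
  M^T = M -> exists s : seq R, (forall a, a \in s -> eigenvalue M a) /\
    forall p : {poly R}, (forall a, a \in s -> p.[a] = 0) -> horner_mx M p = 0.
Proof.
move=> Msym.
have cM : cmx M \is hermsymmx.
  apply: realsym_hermsym.
    apply/is_hermitianmxP; rewrite expr0 scale1r map_mx_id//.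
    by rewrite /cmx map_trmx Msym.
  by apply/mxOverP => i j; rewrite mxE; apply/complex_realP; exists (M i j).
have /orthomx_spectralP := hermitian_normalmx cM.
have /mxOverP dreal := hermitian_spectral_diag_real cM.
set P := spectralmx _; set d := spectral_diag _ => cME.
have Pu : P \in unitmx by exact: spectral_unit.
exists [seq complex.Re (d 0 i) | i <- enum 'I_m.+1].
split=> [a /mapP[i _ ->{a}]|p hp].
  rewrite eigenvalue_root_char -(fmorph_root (real_complex R)) map_char_poly.
  have dE : real_complex R (complex.Re (d 0 i)) = d 0 i := RRe_real (dreal 0 i).
  suff : eigenvalue (cmx M) (d 0 i).
    by rewrite -[X in eigenvalue _ X]dE -eigenvalue_root_char.
  apply/eigenvalueP; exists (row i P); last first.
    apply/negP => /eqP rP; have := row_free_unit P; rewrite Pu.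
    move=> /row_freeP[B] /(congr1 (row i)); rewrite row_mul rP mul0mx => /rowP /(_ i).
    by move=> /eqP; rewrite !mxE eqxx eq_sym oner_eq0.
  rewrite -row_mul cME !mulmxA mulmxV// mul1mx.
  by rewrite row_mul row_diag_mx -scalemxAl -rowE.
apply: cmx_inj; rewrite /cmx map_horner_mx [map_mx _ M]cME map_mx0.
have := @horner_mx_uconj _ _ (map_poly (real_complex R) p) (invmx P) (diag_mx d).
rewrite invmxK unitmx_inv => ->//.
rewrite horner_mx_diag.
suff -> : map_mx (horner (map_poly (real_complex R) p)) d = 0.
  by rewrite linear0 mulmx0 mul0mx.
apply/rowP => i; rewrite !mxE.
have <- : real_complex R (complex.Re (d 0 i)) = d 0 i := RRe_real (dreal 0 i).
rewrite horner_map hp ?rmorph0//.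
by apply/mapP; exists i => //; rewrite mem_enum.
Qed.

Lemma horner_mx_sym m (M : 'M[R]_m.+1) (p : {poly R}) :
  M^T = M -> (horner_mx M p)^T = horner_mx M p.
Proof.
move=> Msym; elim/poly_ind: p => [|p c IH]; first by rewrite rmorph0 trmx0.
rewrite rmorphD rmorphM /= horner_mx_X horner_mx_C linearD/= tr_scalar_mx.
rewrite [X in X + _]trmx_mul Msym IH; congr (_ + _).
exact: comm_mx_horner.
Qed.

(** The root is a polynomial in M, hence symmetric. Interpolating the fourth
    root on the eigenvalues gives T with T ^ 4 = M; then T ^ 2 is a root of M
    that is visibly positive semidefinite, being the square of a symmetric
    matrix. *)
Lemma psd_sqrt_exists m (M : 'M[R]_m) :
  possemidef M -> exists S : 'M[R]_m, possemidef S /\ S *m S = M.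
Proof.
case: m M => [|m] M Mpsd.
  by exists M; split => //; rewrite [LHS]flatmx0 [RHS]flatmx0.
have [s [s_eig s_kill]] := symmetric_annihilated Mpsd.1.
have [p hp] := interpolation (fun a => Num.sqrt (Num.sqrt a)) s.
have pM : (horner_mx M p) ^+ 4 = M.
  apply/eqP; rewrite -subr_eq0 -{2}(horner_mx_X M) -rmorphXn -rmorphB /=.
  apply/eqP/s_kill => a sa; rewrite hornerD hornerN hornerX horner_exp hp//.
  have a0 := psd_eigenvalue_ge0 Mpsd (s_eig _ sa).
  by rewrite (exprM _ 2 2) !sqr_sqrtr ?sqrtr_ge0 ?subrr.
set T := horner_mx M p in pM; have Tsym : T^T = T := horner_mx_sym _ Mpsd.1.
exists (T *m T); split; last by rewrite -[RHS]pM -[4%N]/(2 + 2)%N exprD !expr2.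
split=> [|v]; first by rewrite trmx_mul Tsym.
rewrite mulmxA -mulmxA -{1}Tsym -trmx_mul mxE; apply: sumr_ge0 => i _.
by rewrite mxE -expr2 sqr_ge0.
Qed.

Lemma sqrtmxP m (M : 'M[R]_m) :
  possemidef M -> possemidef (sqrtmx M) /\ sqrtmx M *m sqrtmx M = M.
Proof.
move=> /psd_sqrt_exists exS.
exact: (@xgetPex _ 0 [set S : 'M[R]_m | possemidef S /\ S *m S = M] exS).
Qed.

End MatrixSqrt.

(** * Markov parameters of an externally symmetric system *)

Section ExternalSymmetry.
Context (R : realType).

(** The entrywise 1-norm: it is submultiplicative for all shapes. *)
Definition mxnorm1 m n (M : 'M[R]_(m, n)) : R := \sum_i \sum_j `|M i j|.

Lemma mxnorm1_ge0 m n (M : 'M[R]_(m, n)) : 0 <= mxnorm1 M.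
Proof. by apply: sumr_ge0 => i _; apply: sumr_ge0. Qed.

Lemma ler_mxnorm1 m n (M : 'M[R]_(m, n)) i j : `|M i j| <= mxnorm1 M.
Proof.
rewrite /mxnorm1 (bigD1 i)//= (bigD1 j)//= -addrA lerDl addr_ge0//.
  by apply: sumr_ge0.
by apply: sumr_ge0 => k _; apply: sumr_ge0.
Qed.

Lemma mxnorm1_eq0 m n (M : 'M[R]_(m, n)) : mxnorm1 M = 0 -> M = 0.
Proof.
move=> M0; apply/matrixP => i j; rewrite mxE; apply/eqP.
by rewrite -normr_le0 -M0 ler_mxnorm1.
Qed.

Lemma ler_mxnorm1D m n (M N : 'M[R]_(m, n)) :
  mxnorm1 (M + N) <= mxnorm1 M + mxnorm1 N.
Proof.
rewrite -big_split; apply: ler_sum => i _; rewrite -big_split.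
by apply: ler_sum => j _; rewrite mxE ler_normD.
Qed.

Lemma mxnorm1Z m n c (M : 'M[R]_(m, n)) : mxnorm1 (c *: M) = `|c| * mxnorm1 M.
Proof.
rewrite /mxnorm1 mulr_sumr; apply: eq_bigr => i _; rewrite mulr_sumr.
by apply: eq_bigr => j _; rewrite mxE normrM.
Qed.

Lemma ler_mxnorm1M m n p (M : 'M[R]_(m, n)) (N : 'M[R]_(n, p)) :
  mxnorm1 (M *m N) <= mxnorm1 M * mxnorm1 N.
Proof.
rewrite /mxnorm1 mulr_suml; apply: ler_sum => i _.
apply: (@le_trans _ _ (\sum_j \sum_k `|M i k| * `|N k j|)).
  apply: ler_sum => j _; rewrite mxE; apply: le_trans (ler_norm_sum _ _ _) _.
  by apply: ler_sum => k _; rewrite normrM.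
rewrite exchange_big mulr_suml; apply: ler_sum => k _.
rewrite -mulr_sumr ler_wpM2l// (bigD1 k)//= lerDl.
by apply: sumr_ge0 => l _; apply: sumr_ge0.
Qed.

(** A row vector v with s v = v A has s |v| <= |A| |v|, hence v = 0. *)
Lemma resolvent_exists n (A : 'M[R]_n) (s : R) :
  mxnorm1 A < s -> s%:M - A \in unitmx.
Proof.
move=> As; rewrite -row_free_unit -kermx_eq0; apply/eqP/row_matrixP => i.
rewrite row0; set v := row i _.
have : v *m (s%:M - A) = 0 by rewrite -row_mul mulmx_ker row0.
rewrite mulmxBr mul_mx_scalar => /eqP; rewrite subr_eq0 => /eqP sv.
apply: mxnorm1_eq0; apply/eqP; rewrite eq_le mxnorm1_ge0 andbT.
have s0 : 0 < s by apply: le_lt_trans As; exact: mxnorm1_ge0.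
have := ler_mxnorm1M v A; rewrite -sv mxnorm1Z gtr0_norm// mulrC.
have := mxnorm1_ge0 v; nra.
Qed.

(** The identity s N = 1 + A N for N = (s - A)^-1 makes the resolvent O(1/s). *)
Lemma resolvent_le n (A : 'M[R]_n) (s : R) : mxnorm1 A < s ->
  (s - mxnorm1 A) * mxnorm1 (invmx (s%:M - A)) <= mxnorm1 (1%:M : 'M[R]_n).
Proof.
move=> As; have /mulmxV := resolvent_exists As; set N := invmx _.
rewrite mulmxBl mul_scalar_mx => sN.
have : mxnorm1 (s *: N) <= mxnorm1 (1%:M : 'M[R]_n) + mxnorm1 (A *m N).
  by apply: le_trans (ler_mxnorm1D _ _); rewrite -sN subrK.
have s0 : 0 < s by apply: le_lt_trans As; exact: mxnorm1_ge0.
rewrite mxnorm1Z gtr0_norm// => sN1; have := ler_mxnorm1M A N; lra.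
Qed.

Lemma le0_asymptotic (a K s0 : R) : 0 <= K ->
  (forall s, s0 < s -> (s - s0) * a <= K) -> a <= 0.
Proof.
move=> K0 h; rewrite leNgt; apply/negP => a0.
(* At this point the left-hand side of the hypothesis is K + 1. *)
have := h (s0 + (K + 1) / a).
rewrite ltrDl divr_gt0//; last by lra.
move=> /(_ isT); rewrite addrC addKr divfK ?gt_eqF//; lra.
Qed.

Lemma linear_form_bounded n (phi : {linear 'M[R]_n -> R^o}) :
  exists2 K, 0 <= K & forall M, `|phi M| <= K * mxnorm1 M.
Proof.
exists (\sum_i \sum_j `|phi (delta_mx i j)|).
  by apply: sumr_ge0 => i _; apply: sumr_ge0.
move=> M; rewrite {1}(matrix_sum_delta M) linear_sum.
apply: le_trans (ler_norm_sum _ _ _) _; rewrite mulr_suml; apply: ler_sum => i _.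
rewrite linear_sum; apply: le_trans (ler_norm_sum _ _ _) _.
rewrite mulr_suml; apply: ler_sum => j _.
by rewrite linearZ normrM mulrC ler_wpM2l// ler_mxnorm1.
Qed.

(** The resolvent tends to 0 at infinity, so a linear form that is constant
    along it is 0. *)
Lemma resolvent_cst0 n (A : 'M[R]_n) (phi : {linear 'M[R]_n -> R^o}) (c : R) :
  (forall s : R, mxnorm1 A < s -> phi (invmx (s%:M - A)) = c) -> c = 0.
Proof.
move=> phic; have [K K0 phiK] := linear_form_bounded phi.
apply/eqP; rewrite -normr_le0.
apply: (@le0_asymptotic _ (K * mxnorm1 (1%:M : 'M[R]_n)) (mxnorm1 A)).
  by rewrite mulr_ge0// mxnorm1_ge0.
move=> s As; rewrite -(phic _ As); apply: (@le_trans _ _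
    ((s - mxnorm1 A) * (K * mxnorm1 (invmx (s%:M - A))))).
  by rewrite ler_wpM2l// subr_ge0 ltW.
by rewrite mulrCA ler_wpM2l// resolvent_le.
Qed.

(** Multiplying the resolvent by A shifts the sequence of Markov parameters,
    because A (s - A)^-1 = s (s - A)^-1 - 1. *)
Lemma markov_parameters_eq0 n (A : 'M[R]_n) k (phi : {linear 'M[R]_n -> R^o}) :
  (forall s : R, mxnorm1 A < s -> phi (invmx (s%:M - A)) = 0) ->
  phi (A ^+ k) = 0.
Proof.
elim: k phi => [|k IH] phi phi0.
(* The base case and the inductive step both need phi 1 = 0, which comes from
   evaluating phi on A (s - A)^-1. *)
all: have Ainv (s : R) : mxnorm1 A < s ->
      (phi \o mulmx A) (invmx (s%:M - A)) = - phi 1%:M.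
  1,3: move=> As; have /mulmxV := resolvent_exists As; rewrite mulmxBl mul_scalar_mx.
  1,2: move=> /(congr1 phi); rewrite linearB linearZ/= phi0// scaler0 sub0r.
  1,2: by move=> <-; rewrite opprK.
all: have /eqP := resolvent_cst0 Ainv; rewrite oppr_eq0 => /eqP phi1.
  by rewrite expr0.
rewrite exprS; apply: (IH (phi \o mulmx A)) => s As.
by apply: etrans (Ainv _ As) _; rewrite phi1 oppr0.
Qed.

Lemma transfer_real n m (A : 'M[R]_n) (B : 'M[R]_(n, m)) (C : 'M[R]_(m, n))
    (D : 'M[R]_m) (s : R) :
  transfer A B C D (real_complex R s) =
  cmx (C *m invmx (s%:M - A) *m B + D).
Proof.
rewrite /transfer /cmx map_mxD !map_mxM map_invmx map_mxB map_scalar_mx.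
by [].
Qed.

(** External symmetry of the transfer function is inherited by the feedthrough
    and by all Markov parameters, i.e. by the expansion of G at infinity. *)
Lemma external_symmetry_markov n m (A : 'M[R]_n) (B : 'M[R]_(n, m))
    (C : 'M[R]_(m, n)) (D S : 'M[R]_m) :
  externally_symmetric A B C D S ->
  S *m D^T = D *m S /\
  forall k, S *m (C *m A ^+ k *m B)^T = C *m A ^+ k *m B *m S.
Proof.
move=> symG.
(* The defect of symmetry, as a linear form in the matrix between C and B. *)
pose phi i j (M : 'M[R]_n) : R^o :=
  (S *m (C *m M *m B)^T - C *m M *m B *m S) i j.
have phi_lin i j : linear (phi i j).
  move=> a M N; rewrite /phi mulmxDr mulmxDl -scalemxAr -scalemxAl.
  rewrite linearD/= linearZ/= mulmxDr mulmxDl -scalemxAr -scalemxAl.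
  by rewrite !mxE /GRing.scale/=; ring.
pose phiL i j := HB.pack_for {linear 'M[R]_n -> R^o} (phi i j)
  (GRing.isLinear.Build _ _ _ _ (phi i j) (phi_lin i j)).
have key (s : R) i j : mxnorm1 A < s ->
    phiL i j (invmx (s%:M - A)) = - (S *m D^T - D *m S) i j.
  move=> As; have := symG (real_complex R s).
  rewrite transfer_real -map_scalar_mx -map_mxB map_unitmx resolvent_exists//.
  move=> /(_ isT); rewrite /cmx map_trmx -!map_mxM => /cmx_inj/eqP.
  rewrite -subr_eq0 linearD/= mulmxDr mulmxDl opprD addrACA addr_eq0.
  by move=> /eqP MN; rewrite /phi MN [LHS]mxE.
have d0 i j : (S *m D^T - D *m S) i j = 0.
  apply/eqP; rewrite -oppr_eq0; apply/eqP.
  by apply: (@resolvent_cst0 _ A (phiL i j)) => s; exact: key.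
split.
  by apply/eqP; rewrite -subr_eq0; apply/eqP/matrixP => i j; rewrite d0 mxE.
move=> k; apply/eqP; rewrite -subr_eq0; apply/eqP/matrixP => i j; rewrite [RHS]mxE.
suff : phiL i j (A ^+ k) = 0 by [].
apply: markov_parameters_eq0 => s As.
by rewrite key// d0 oppr0.
Qed.

End ExternalSymmetry.

(** * The matrix exponential and the impulse response *)

Lemma cvgr_sum (R : realType) (T : Type) (F : set_system T) (FF : Filter F)
    (I : Type) (r : seq I) (f : I -> T -> R) (a : I -> R) :
  (forall i, f i x @[x --> F] --> a i) ->
  \sum_(i <- r) f i x @[x --> F] --> \sum_(i <- r) a i.
Proof.
move=> fa; elim: r => [|i r IH].
  by under eq_fun do rewrite big_nil; rewrite big_nil; exact: cvg_cst.
under eq_fun do rewrite big_cons; rewrite big_cons.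
exact: cvgD (fa i) IH.
Qed.

Section MatrixExponential.
Context (R : realType) (n : nat).
Implicit Types (A M : 'M[R]_n).

Lemma mxnorm1X M k : mxnorm1 (M ^+ k) <= mxnorm1 (1%:M : 'M[R]_n) * mxnorm1 M ^+ k.
Proof.
elim: k => [|k IH]; first by rewrite !expr0 mulr1.
rewrite exprS exprSr mulrA mulrC; apply: le_trans (ler_mxnorm1M _ _) _.
by rewrite ler_wpM2l// mxnorm1_ge0.
Qed.

(** Domination by the scalar exponential series. The shift p serves the
    derivatives of the series as well as the series itself. *)
Lemma expmx_cvg_subproof M p t i j :
  cvgn (pseries (fun k => (k`!%:R)^-1 * (M ^+ (k + p)) i j) t).
Proof.
apply: normed_cvg.
pose K := mxnorm1 (1%:M : 'M[R]_n) * mxnorm1 M ^+ p.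
apply: (@series_le_cvg _ _ (K *: exp_coeff (mxnorm1 M * `|t|))) => [k|k|k|].
- exact: normr_ge0.
- rewrite /exp_coeff/= fctE mulr_ge0//.
    by rewrite mulr_ge0// ?exprn_ge0// mxnorm1_ge0.
  by rewrite divr_ge0// exprn_ge0// mulr_ge0// mxnorm1_ge0.
- rewrite /= normrM normrX normrM ger0_norm ?invr_ge0//.
  rewrite fctE /exp_coeff /= /GRing.scale/= exprMn.
  rewrite [X in X <= _](_ : _ = `|(M ^+ (k + p)) i j| * (`|t| ^+ k / k`!%:R)); last by ring.
  rewrite [X in _ <= X](_ : _ = (K * mxnorm1 M ^+ k) * (`|t| ^+ k / k`!%:R)); last by ring.
  rewrite ler_wpM2r ?divr_ge0 ?exprn_ge0//.
  apply: le_trans (ler_mxnorm1 _ _ _) _; apply: le_trans (mxnorm1X _ _) _.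
  by rewrite /K -mulrA -exprD addnC.
- exact/is_cvg_seriesZ/is_cvg_series_exp_coeff.
Qed.

Lemma exprmxZ A t k : (t *: A) ^+ k = t ^+ k *: A ^+ k.
Proof.
elim: k => [|k IH]; first by rewrite !expr0 scale1r.
rewrite exprS IH -[LHS]/((t *: A) *m (t ^+ k *: A ^+ k)).
by rewrite -scalemxAl -scalemxAr scalerA -exprS (exprS A).
Qed.

Lemma expmxE A t i j :
  expmx (t *: A) i j = limn (pseries (fun k => (k`!%:R)^-1 * (A ^+ k) i j) t).
Proof.
rewrite mxE; congr (limn _); apply/funext => N; rewrite /pseries /series/=.
apply: eq_bigr => k _; rewrite exprmxZ !mxE.
by rewrite mulrA mulrAC.
Qed.

Lemma expmx_bilinear_cvg A t p q (X : 'M[R]_(p, n)) (Y : 'M[R]_(n, q)) i j :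
  pseries (fun k => (k`!%:R)^-1 * (X *m A ^+ k *m Y) i j) t @ \oo -->
  (X *m expmx (t *: A) *m Y) i j.
Proof.
rewrite [X in X @ _ --> _](_ : _ = (fun N => \sum_l \sum_m (X i m *
   pseries (fun k => (k`!%:R)^-1 * (A ^+ k) m l) t N) * Y l j)); last first.
  apply/funext => N; rewrite /pseries /series/=.
  under [RHS]eq_bigr do under eq_bigr do rewrite mulr_sumr mulr_suml.
  under [RHS]eq_bigr do rewrite exchange_big/=.
  rewrite [RHS]exchange_big/=; apply: eq_bigr => k _.
  rewrite mxE mulr_sumr mulr_suml; apply: eq_bigr => l _.
  rewrite mxE mulr_suml mulr_sumr mulr_suml; apply: eq_bigr => m _.
  by ring.
rewrite mxE; apply: cvgr_sum => l; rewrite mxE mulr_suml.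
apply: cvgr_sum => m; apply: cvgM; last exact: cvg_cst.
apply: cvgM; first exact: cvg_cst.
rewrite expmxE; have := @expmx_cvg_subproof A 0 t m l.
by under eq_fun do rewrite addn0.
Qed.

(** The entries of X exp(tA) Y are power series in t with coefficients
    X A^k Y / k!, so an identity between Markov parameters passes to the
    impulse response. Different index pairs allow for a transposition. *)
Lemma expmx_bilinear_eq A t p q (X X' : 'M[R]_(p, n)) (Y Y' : 'M[R]_(n, q)) i j i' j' :
  (forall k, (X *m A ^+ k *m Y) i j = (X' *m A ^+ k *m Y') i' j') ->
  (X *m expmx (t *: A) *m Y) i j = (X' *m expmx (t *: A) *m Y') i' j'.
Proof.
move=> XY; have := @expmx_bilinear_cvg A t p q X Y i j.
rewrite (_ : (fun k => _) = (fun k => (k`!%:R)^-1 * (X' *m A ^+ k *m Y') i' j')); last first.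
  by apply/funext => k; rewrite XY.
move=> /(@cvg_unique _ (@norm_hausdorff _ _)); apply.
exact: expmx_bilinear_cvg.
Qed.

Lemma expmx_comm A t : A *m expmx (t *: A) = expmx (t *: A) *m A.
Proof.
apply/matrixP => i j.
have := @expmx_bilinear_eq A t n n A 1%:M 1%:M A i j i j.
rewrite mulmx1 mul1mx; apply => k; rewrite mulmx1 mul1mx.
by rewrite -[LHS]/((A * A ^+ k) i j) -exprS exprSr.
Qed.

Lemma expmx0 A : expmx (0 *: A) = 1%:M.
Proof.
apply/matrixP => i j; rewrite expmxE; apply: cvg_lim => //.
rewrite -cvg_shiftS /= (_ : (fun N => _) = (fun=> 1%:M i j)); first exact: cvg_cst.
apply/funext => N; rewrite /pseries /series/=.
rewrite big_nat_recl// big1 ?addr0; first by rewrite expr0 !mulr1 fact0 invr1 mul1r.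
by move=> k _; rewrite expr0n mulr0.
Qed.

Lemma is_derive_expmx A t i j :
  is_derive t (1 : R) (fun s => expmx (s *: A) i j) ((A *m expmx (t *: A)) i j).
Proof.
pose c p k := (k`!%:R)^-1 * (A ^+ (k + p)) i j.
have -> : (fun s => expmx (s *: A) i j) = (fun s => limn (pseries (c 0%N) s)).
  apply/funext => s; rewrite expmxE; congr (limn (pseries _ _)).
  by apply/funext => k; rewrite /c addn0.
have dc p : pseries_diffs (c p) = c p.+1.
  apply/funext => k; rewrite /pseries_diffs /c factS natrM invfM !mulrA.
  by rewrite mulfV// mul1r addSnnS.
suff <- : limn (pseries (c 1%N) t) = (A *m expmx (t *: A)) i j.
  rewrite -dc; apply: (@pseries_snd_diffs _ _ (`|t| + 1)); rewrite ?dc.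
  1,2,3: exact: expmx_cvg_subproof.
  by rewrite [ltRHS]ger0_norm ?ltrDl// addr_ge0.
apply: cvg_lim => //; rewrite -[A *m _]mulmx1.
have := @expmx_bilinear_cvg A t _ _ A 1%:M i j.
rewrite (_ : (fun k => _) = c 1%N)//.
by apply/funext => k; rewrite mulmx1 /c addn1 exprS.
Qed.

End MatrixExponential.

Section MatrixExponentialGroup.
Context (R : realType).

Lemma is_derive_mulmx p n q (F : R -> 'M[R]_(p, n)) (G : R -> 'M[R]_(n, q))
    (F' : 'M[R]_(p, n)) (G' : 'M[R]_(n, q)) (t : R) :
  (forall i j, is_derive t (1 : R) (fun s => F s i j) (F' i j)) ->
  (forall i j, is_derive t (1 : R) (fun s => G s i j) (G' i j)) ->
  forall i j, is_derive t (1 : R) (fun s => (F s *m G s) i j)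
    ((F' *m G t + F t *m G') i j).
Proof.
move=> dF dG i j.
have -> : (fun s => (F s *m G s) i j) =
    \sum_(k < n) ((fun s => F s i k) * (fun s => G s k j)).
  by apply/funext => s; rewrite mxE fct_sumE.
apply: is_derive_eq.
rewrite !mxE -big_split/=; apply: eq_bigr => k _.
by rewrite /GRing.scale/=; ring.
Qed.

Lemma is_derive_expmx_shift n (A : 'M[R]_n) a t i j :
  is_derive t (1 : R) (fun s => expmx ((s + a) *: A) i j)
    ((A *m expmx ((t + a) *: A)) i j).
Proof.
have dE := is_derive_expmx A (t + a) i j.
have := @is_derive1_comp R (fun s => expmx (s *: A) i j) (shift a) t _ 1 dE.
by rewrite mulr1; apply; exact: is_derive_shift.
Qed.

Lemma is_derive_expmxN n (A : 'M[R]_n) t i j :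
  is_derive t (1 : R) (fun s => expmx ((- s) *: A) i j)
    ((- (A *m expmx ((- t) *: A))) i j).
Proof.
under eq_fun do rewrite scaleNr -scalerN.
rewrite scaleNr -scalerN; have := is_derive_expmx (- A) t i j.
by rewrite mulNmx.
Qed.

(** The left-hand side has derivative 0 in t, and t = 0 gives the right-hand
    side. *)
Lemma expmxN_mul n (A : 'M[R]_n) t a :
  expmx ((- t) *: A) *m expmx ((t + a) *: A) = expmx (a *: A).
Proof.
pose F t := expmx ((- t) *: A) *m expmx ((t + a) *: A).
have F0 : F 0 = expmx (a *: A) by rewrite /F oppr0 expmx0 mul1mx add0r.
suff dF i j s : is_derive s (1 : R) (fun t => F t i j) 0.
  rewrite -F0; apply/matrixP => i j.
  exact: (@is_derive_0_is_cst R (fun t => F t i j) t 0 (dF i j)).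
have := @is_derive_mulmx _ _ _ (fun t => expmx ((- t) *: A))
  (fun t => expmx ((t + a) *: A)) _ _ s (is_derive_expmxN A s)
  (is_derive_expmx_shift A a s) i j.
rewrite mulmxA (expmx_comm A (- s)) mulNmx addNr [X in is_derive _ _ _ X -> _]mxE.
exact.
Qed.

Lemma expmxNK n (A : 'M[R]_n) t : expmx ((- t) *: A) *m expmx (t *: A) = 1%:M.
Proof. by have := expmxN_mul A t 0; rewrite addr0 expmx0. Qed.

Lemma expmxKN n (A : 'M[R]_n) t : expmx (t *: A) *m expmx ((- t) *: A) = 1%:M.
Proof. by have := expmxNK A (- t); rewrite opprK. Qed.

Lemma expmxB n (A : 'M[R]_n) t s :
  expmx ((t - s) *: A) = expmx (t *: A) *m expmx ((- s) *: A).
Proof. by rewrite -(expmxN_mul A t (- s)) mulmxA expmxKN mul1mx. Qed.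

Lemma impulse_response_symmetric n m (A : 'M[R]_n) (B : 'M[R]_(n, m))
    (C : 'M[R]_(m, n)) (D S : 'M[R]_m) t :
  externally_symmetric A B C D S -> S^T = S ->
  S *m (C *m expmx (t *: A) *m B)^T = C *m expmx (t *: A) *m B *m S.
Proof.
move=> /external_symmetry_markov[_ symM] Ssym; apply/matrixP => i j.
rewrite -{1}Ssym -trmx_mul mxE -!mulmxA !(mulmxA C).
apply: expmx_bilinear_eq => k; rewrite !mulmxA.
by rewrite -[in LHS]symM -{1}Ssym -trmx_mul mxE.
Qed.

End MatrixExponentialGroup.

(** * Fubini on a triangle, integration by parts and reflection *)

Section RealIntegrable.
Context d (T : measurableType d) (R : realType).
Context (mu : {measure set T -> \bar R}) (D : set T) (mD : measurable D).
Notation itg f := (mu.-integrable D (EFin \o f)).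
Implicit Types (f g : T -> R).

Lemma integrable_mulrl c f : itg f -> itg (fun x => c * f x).
Proof. by move=> fi; have := integrableZl mD c fi. Qed.

Lemma integrable_addr f g : itg f -> itg g -> itg (fun x => f x + g x).
Proof. by move=> fi gi; have := integrableD mD fi gi. Qed.

Lemma integrable_subr f g : itg f -> itg g -> itg (fun x => f x - g x).
Proof. by move=> fi gi; have := integrableB mD fi gi. Qed.

Lemma integrable_sumr (I : Type) (r : seq I) (f : I -> T -> R) :
  (forall i, itg (f i)) -> itg (fun x => \sum_(i <- r) f i x).
Proof.
move=> fi; elim: r => [|i r IH].
  rewrite (_ : EFin \o _ = cst 0%E); first exact: integrable0.
  by apply/funext => x /=; rewrite big_nil.
rewrite (_ : EFin \o _ = EFin \o (fun x => f i x + \sum_(j <- r) f j x)).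
  exact: integrable_addr.
by apply/funext => x /=; rewrite big_cons.
Qed.

Lemma Rintegral_sum (I : Type) (r : seq I) (f : I -> T -> R) :
  (forall i, itg (f i)) ->
  \int[mu]_(x in D) (\sum_(i <- r) f i x) = \sum_(i <- r) \int[mu]_(x in D) f i x.
Proof.
move=> fi; elim: r => [|i r IH].
  under eq_Rintegral do rewrite big_nil.
  by rewrite big_nil /Rintegral integral0.
under eq_Rintegral do rewrite big_cons.
by rewrite big_cons RintegralD// ?IH//; exact: integrable_sumr.
Qed.

Lemma ge0_integrableP f : measurable_fun D f -> (forall x, 0 <= f x) ->
  itg f <-> (\int[mu]_(x in D) (f x)%:E < +oo)%E.
Proof.
move=> mf f0; have fE : (\int[mu]_(x in D) `|(EFin \o f) x| =
    \int[mu]_(x in D) (f x)%:E)%E.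
  by apply: eq_integral => x _; rewrite /= ger0_norm.
split=> [/integrableP[_]|foo]; first by rewrite fE.
by apply/integrableP; split; [exact/measurable_EFinP|rewrite fE].
Qed.

End RealIntegrable.

Section VolterraIntegral.
Context (R : realType).
Notation mu := (@lebesgue_measure R).
Implicit Types (f g a b : R -> R) (T t : R).

Lemma EFin_Rintegral (D : set R) f : measurable D ->
  mu.-integrable D (EFin \o f) ->
  (\int[mu]_(x in D) f x)%:E = (\int[mu]_(x in D) (f x)%:E)%E.
Proof. by move=> mD fi; rewrite fineK//; exact: integrable_fin_num. Qed.

Lemma integrable_subitv f T s t : 0 <= s -> t <= T ->
  mu.-integrable `[0, T] (EFin \o f) -> mu.-integrable `[s, t] (EFin \o f).
Proof.
move=> s0 tT; apply: integrableS => //.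
by apply: subset_itvScc; rewrite bnd_simp.
Qed.

Let triangle a b : measurableTypeR R * measurableTypeR R -> \bar R :=
  fun z => (if z.2 <= z.1 then b z.1 * a z.2 else 0)%:E.

Let measurable_triangle a b : measurable_fun setT a -> measurable_fun setT b ->
  measurable_fun setT (triangle a b).
Proof.
move=> ma mb; apply/measurable_EFinP; apply: measurable_fun_ifT => //.
  by apply: measurable_fun_ler; [exact: measurable_snd|exact: measurable_fst].
by apply: measurable_funM; apply: measurableT_comp.
Qed.

Let integrable_triangle a b :
  mu.-integrable setT (EFin \o a) -> mu.-integrable setT (EFin \o b) ->
  (mu \x mu)%E.-integrable setT (triangle a b).
Proof.
move=> ia ib; have ma : measurable_fun setT a.
  by apply/measurable_EFinP; case/integrableP : ia.
have mb : measurable_fun setT b by apply/measurable_EFinP; case/integrableP : ib.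
apply/integrable12ltyP; first exact: measurable_triangle.
have [_ ia'] := integrableP _ _ _ ia; have [_ ib'] := integrableP _ _ _ ib.
apply: (@le_lt_trans _ _
    (\int[mu]_x (`|b x|%:E * \int[mu]_y `|a y|%:E))%E).
  apply: ge0_le_integral => //.
  - by move=> x _; apply: integral_ge0.
  - apply: (measurable_fun_fubini_tonelli_F (abse \o triangle a b)) => //=.
    by apply: measurableT_comp => //; exact: measurable_triangle.
  - apply: emeasurable_funM => //; apply/measurable_EFinP.
    exact: measurableT_comp.
  move=> x _; rewrite -ge0_integralZl//; last first.
    by apply/measurable_EFinP; exact: measurableT_comp.
  apply: ge0_le_integral => //.
  - apply: measurableT_comp => //.
    apply: (measurableT_comp (f := triangle a b)) => //.
    exact: measurable_triangle.
  - by apply: emeasurable_funM => //; apply/measurable_EFinP; exact: measurableT_comp.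
  move=> y _; rewrite /triangle/= lee_fin.
  by case: ifP => _; rewrite ?normrM// normr0 mulr_ge0.
rewrite ge0_integralZr//; last 2 first.
- by apply/measurable_EFinP; exact: measurableT_comp.
- exact: integral_ge0.
by rewrite lte_mul_pinfty//; [exact: integral_ge0|rewrite ge0_fin_numE//; exact: integral_ge0].
Qed.

Let triangle_section1 a b x : mu.-integrable setT (EFin \o a) ->
  (\int[mu]_y triangle a b (x, y))%E =
  (b x * \int[mu]_(y in `]-oo, x]) a y)%:E.
Proof.
move=> ia; have iax : mu.-integrable `]-oo, x] (EFin \o a).
  exact: integrableS ia.
rewrite -RintegralZl// EFin_Rintegral//; last exact: integrable_mulrl.
rewrite [RHS]integral_mkcond; apply: eq_integral => y _.
by rewrite /triangle/= patchE mem_setE/= in_itv/=; case: ifP.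
Qed.

Let triangle_section2 a b y : mu.-integrable setT (EFin \o b) ->
  (\int[mu]_x triangle a b (x, y))%E =
  (a y * \int[mu]_(x in `[y, +oo[) b x)%:E.
Proof.
move=> ib; have iby : mu.-integrable `[y, +oo[ (EFin \o b).
  exact: integrableS ib.
rewrite -RintegralZl// EFin_Rintegral//; last exact: integrable_mulrl.
rewrite [RHS]integral_mkcond; apply: eq_integral => x _.
by rewrite /triangle/= patchE mem_setE/= in_itv/= andbT mulrC; case: ifP.
Qed.

(** Both sides integrate b t * a s over the triangle 0 <= s <= t <= T. The
    functions are extended by 0 to the whole line, where Fubini's theorem
    applies to the product of Lebesgue measure with itself. *)
Lemma Rintegral_triangle a b T :
  mu.-integrable `[0, T] (EFin \o a) -> mu.-integrable `[0, T] (EFin \o b) ->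
  \int[mu]_(t in `[0, T]) (b t * \int[mu]_(s in `[0, t]) a s) =
  \int[mu]_(s in `[0, T]) (a s * \int[mu]_(t in `[s, T]) b t).
Proof.
move=> ia ib; pose a0 := a \_ `[0, T]; pose b0 := b \_ `[0, T].
have ia0 : mu.-integrable setT (EFin \o a0).
  by rewrite -restrict_EFin; apply/integrable_restrict => //=; rewrite setTI.
have ib0 : mu.-integrable setT (EFin \o b0).
  by rewrite -restrict_EFin; apply/integrable_restrict => //=; rewrite setTI.
have F : \int[mu]_t (b0 t * \int[mu]_(s in `]-oo, t]) a0 s) =
    \int[mu]_s (a0 s * \int[mu]_(t in `[s, +oo[) b0 t).
  have := Fubini (integrable_triangle ia0 ib0).
  under eq_integral do rewrite triangle_section1//.
  under [in RHS]eq_integral do rewrite triangle_section2//.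
  exact: (congr1 fine).
rewrite [LHS]Rintegral_mkcond [RHS]Rintegral_mkcond.
transitivity (\int[mu]_t (b0 t * \int[mu]_(s in `]-oo, t]) a0 s)).
  apply: eq_Rintegral => t _; rewrite /b0 !patchE.
  case: ifPn => [|_]; last by rewrite mul0r.
  rewrite mem_setE/= in_itv/= => /andP[t0 tT]; congr (_ * _).
  rewrite -Rintegral_mkcondr; congr Rintegral.
  apply/seteqP; split => s /=; rewrite !in_itv/=.
    move=> /andP[s0 st]; split=> //; rewrite s0/=; exact: le_trans st tT.
  by move=> [-> /andP[->]].
rewrite F; apply: eq_Rintegral => s _; rewrite /a0 !patchE.
case: ifPn => [|_]; last by rewrite mul0r.
rewrite mem_setE/= in_itv/= => /andP[s0 sT]; congr (_ * _).
rewrite -Rintegral_mkcondr; congr Rintegral.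
apply/seteqP; split => t /=; rewrite !in_itv/= andbT.
  by move=> [-> /andP[_ ->]].
move=> /andP[st tT]; split=> //; rewrite tT andbT; exact: le_trans s0 st.
Qed.

End VolterraIntegral.

Section BoundedMeasurable.
Context (R : realType).
Notation mu := (@lebesgue_measure R).
Implicit Types (f g p a : R -> R).

Definition bounded_measurable (D : set R) f : Prop :=
  measurable_fun D f /\ exists M, forall x, D x -> `|f x| <= M.

Lemma bounded_measurable_cst (D : set R) (c : R) : bounded_measurable D (fun=> c).
Proof. by split; [exact: measurable_cst | exists `|c|]. Qed.

Lemma bounded_measurableD (D : set R) f g :
  bounded_measurable D f -> bounded_measurable D g ->
  bounded_measurable D (fun x => f x + g x).
Proof.
move=> [mf [M fM]] [mg [N gN]]; split; first exact: measurable_funD.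
exists (M + N) => x Dx; apply: le_trans (ler_normD _ _) _.
by rewrite lerD ?fM ?gN.
Qed.

Lemma bounded_measurableM (D : set R) f g :
  bounded_measurable D f -> bounded_measurable D g ->
  bounded_measurable D (fun x => f x * g x).
Proof.
move=> [mf [M fM]] [mg [N gN]]; split; first exact: measurable_funM.
by exists (M * N) => x Dx; rewrite normrM ler_pM ?fM ?gN.
Qed.

Lemma bounded_measurable_sum (D : set R) (I : Type) (r : seq I) (f : I -> R -> R) :
  (forall i, bounded_measurable D (f i)) ->
  bounded_measurable D (fun x => \sum_(i <- r) f i x).
Proof.
move=> fb; elim: r => [|i r IH].
  under eq_fun do rewrite big_nil; exact: bounded_measurable_cst.
under eq_fun do rewrite big_cons; exact: bounded_measurableD.
Qed.

Lemma within_continuous_bounded_measurable (a b : R) f :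
  {within `[a, b], continuous f} -> bounded_measurable `[a, b] f.
Proof.
move=> cf; split; first exact: subspace_continuous_measurable_fun.
have /compact_bounded[M [_ Mf]] := continuous_compact cf (@segment_compact _ a b).
exists (M + 1) => x xab; apply: (Mf (M + 1)); last by exists x.
by rewrite ltrDl.
Qed.

Lemma continuous_bounded_measurable (a b : R) f :
  continuous f -> bounded_measurable `[a, b] f.
Proof.
by move=> cf; apply/within_continuous_bounded_measurable/continuous_subspaceT.
Qed.

Lemma bounded_measurable_mul_integrable (D : set (measurableTypeR R)) p a :
  measurable D -> bounded_measurable D p -> mu.-integrable D (EFin \o a) ->
  mu.-integrable D (EFin \o (fun x => p x * a x)).
Proof.
move=> mD [mp [M pM]] ia.
have bp : [bounded p x | x in D].
  exists M; split; first exact: num_real.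
  by move=> N MN x Dx; apply: le_trans (pM _ Dx) (ltW MN).
by have := integrableMr mD mp bp ia.
Qed.

Lemma bounded_measurable_integrable (a b : R) f :
  bounded_measurable `[a, b] f -> mu.-integrable `[a, b] (EFin \o f).
Proof.
move=> bf; rewrite (_ : EFin \o f = EFin \o (fun x => f x * 1)); last first.
  by apply/funext => x; rewrite /= mulr1.
apply: bounded_measurable_mul_integrable => //.
have : {within `[a, b], continuous (fun=> 1 : R)}.
  by apply: continuous_subspaceT => x; exact: cvg_cst.
by apply: continuous_compact_integrable; exact: segment_compact.
Qed.

Lemma Rintegral_derivative p p1 s t : s <= t ->
  (forall x, is_derive x (1 : R) p (p1 x)) -> continuous p1 ->
  \int[mu]_(x in `[s, t]) p1 x = p t - p s.
Proof.
rewrite le_eqVlt => /predU1P[<-|st] dp cp1.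
  by rewrite set_itv1 Rintegral_set1 subrr.
rewrite /Rintegral (@continuous_FTC2 _ p1 p)//.
- exact: continuous_subspaceT.
- have cp x : {for x, continuous p}.
    apply: differentiable_continuous; apply/derivable1_diffP.
    by have [] := dp x.
  split; [by move=> x _; have [] := dp x| |].
  + exact: cvg_at_right_filter (cp _).
  + exact: cvg_at_left_filter (cp _).
- by move=> x _; rewrite derive1E; have [] := dp x.
Qed.

(** Integration by parts against a merely integrable density a: it is the
    triangle Fubini identity, since p t - p s is the integral of p'. *)
Lemma volterra_by_parts p p1 a T t :
  (forall x, is_derive x (1 : R) p (p1 x)) -> continuous p1 ->
  mu.-integrable `[0, T] (EFin \o a) -> 0 <= t <= T ->
  p t * \int[mu]_(s in `[0, t]) a s =
  \int[mu]_(s in `[0, t]) (p1 s * \int[mu]_(r in `[0, s]) a r + p s * a s).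
Proof.
move=> dp cp1 ia /andP[t0 tT].
have iat : mu.-integrable `[0, t] (EFin \o a) by exact: integrable_subitv ia.
have cp : continuous p.
  move=> x; apply: differentiable_continuous; apply/derivable1_diffP.
  by have [] := dp x.
have ip1 : mu.-integrable `[0, t] (EFin \o p1).
  exact/bounded_measurable_integrable/continuous_bounded_measurable.
have ipa : mu.-integrable `[0, t] (EFin \o (fun s => p s * a s)).
  apply: bounded_measurable_mul_integrable => //.
  exact: continuous_bounded_measurable.
rewrite RintegralD//; last first.
  apply: bounded_measurable_integrable; apply: bounded_measurableM.
    exact: continuous_bounded_measurable.
  by apply: within_continuous_bounded_measurable; exact: parameterized_integral_continuous.
have iB : mu.-integrable `[0, t] (EFin \o (fun s => a s * \int[mu]_(r in `[s, t]) p1 r)).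
  have : mu.-integrable `[0, t] (EFin \o (fun s => p t * a s - p s * a s)).
    by apply: integrable_subr => //; exact: integrable_mulrl.
  apply: eq_integrable => // s; rewrite inE/= in_itv/= => /andP[s0 st].
  by rewrite (Rintegral_derivative st dp cp1) mulrBr !(mulrC (a s)).
rewrite Rintegral_triangle// -RintegralD//.
rewrite -RintegralZl//; apply: eq_Rintegral => s; rewrite inE/= in_itv/= => /andP[s0 st].
by rewrite (Rintegral_derivative st dp cp1); ring.
Qed.

End BoundedMeasurable.

Section Reflection.
Context (R : realType).
Notation mu := (@lebesgue_measure R).

Let reflection (T : R) : measurableTypeR R -> measurableTypeR R := fun x => T - x.

Let measurable_reflection T : measurable_fun setT (reflection T).
Proof. by apply: measurable_funB. Qed.

Let lebesgue_measure_reflection T (A : set R) : measurable A ->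
  pushforward mu (reflection T) A = mu A.
Proof.
move=> mA; apply/esym/lebesgue_measure_unique => //= _ [[a b]] _ <-.
rewrite /pushforward/= (_ : _ @^-1` _ = `[T - b, T - a[%classic); last first.
  by apply/seteqP; split => x /=; rewrite /reflection !in_itv/=; lra.
by rewrite !lebesgue_measure_itv/= !lte_fin; congr (if _ then _ else _); [lra|congr EFin; lra].
Qed.

Let ge0_integral_reflection (T : R) (D : set (measurableTypeR R))
    (f : measurableTypeR R -> \bar R) :
  measurable D -> measurable_fun D f -> (forall x, (0 <= f x)%E) ->
  (\int[mu]_(x in reflection T @^-1` D) (f \o reflection T) x =
   \int[mu]_(x in D) f x)%E.
Proof.
move=> mD mf f0.
rewrite -(@ge0_integral_pushforward _ _ _ _ _ _ (measurable_reflection T) mu D f)//.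
by apply: eq_measure_integral => //= A mA AS; exact: lebesgue_measure_reflection.
Qed.

(** Lebesgue measure is invariant under reflections, because intervals keep
    their length; an integral is then transported as one for a pushforward
    measure, separately for the positive and negative parts. *)
Lemma Rintegral_reflection (T t : R) (g : R -> R) : measurable_fun `[t, T] g ->
  \int[mu]_(x in `[0, T - t]) g (T - x) = \int[mu]_(x in `[t, T]) g x.
Proof.
move=> mg; rewrite /Rintegral; congr fine.
rewrite (_ : `[0, T - t]%classic = reflection T @^-1` `[t, T]); last first.
  by apply/seteqP; split => x /=; rewrite /reflection !in_itv/=; lra.
rewrite [RHS]integralE [LHS]integralE.
have mEg : measurable_fun `[t, T] (EFin \o g) by exact/measurable_EFinP.
rewrite -[in RHS](@ge0_integral_reflection T)//; last exact: measurable_funepos.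
rewrite -[X in _ = (_ - X)%E](@ge0_integral_reflection T)//; last exact: measurable_funeneg.
by rewrite -funepos_comp -funeneg_comp.
Qed.

End Reflection.

(** * The space of square integrable signals *)

Section LebesgueAlmostEverywhere.
Context (R : realType).
Notation mu := (@lebesgue_measure R).

Lemma ae_imply (P Q : R -> Prop) : (forall t, P t -> Q t) ->
  (\forall t \ae mu, P t) -> \forall t \ae mu, Q t.
Proof.
by move=> PQ; apply: filterS => //; exact: (ae_filter_ringOfSetsType mu).
Qed.

Lemma ae_imply2 (P Q S : R -> Prop) : (forall t, P t -> Q t -> S t) ->
  (\forall t \ae mu, P t) -> (\forall t \ae mu, Q t) -> \forall t \ae mu, S t.
Proof.
by move=> PQ; apply: filterS2 => //; exact: (ae_filter_ringOfSetsType mu).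
Qed.

End LebesgueAlmostEverywhere.

Section L2Space.
Context (R : realType) (tf : R).
Notation mu := (@lebesgue_measure R).
Notation itg f := (mu.-integrable `[0, tf] (EFin \o f)).
Implicit Types (f g : R -> R).

Definition square_integrable f : Prop :=
  measurable_fun `[0, tf] f /\ itg (fun t => f t ^+ 2).

Lemma square_integrable_mul f g :
  square_integrable f -> square_integrable g -> itg (fun t => f t * g t).
Proof.
move=> [mf fi] [mg gi]; have : itg (fun t => f t ^+ 2 + g t ^+ 2) by exact: integrable_addr.
apply: le_integrable => //.
  by apply/measurable_EFinP; exact: measurable_funM.
move=> t _ /=; rewrite lee_fin normrM [leRHS]ger0_norm ?addr_ge0 ?sqr_ge0//.
rewrite -(real_normK (num_real (f t))) -(real_normK (num_real (g t))).
have := sqr_ge0 (`|f t| - `|g t|); nra.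
Qed.

Lemma square_integrable_bounded f :
  bounded_measurable `[0, tf] f -> square_integrable f.
Proof.
move=> bf; split; first by case: bf.
under [X in integrable _ _ X]eq_fun do rewrite /= expr2.
by apply: bounded_measurable_integrable; exact: bounded_measurableM.
Qed.

Lemma square_integrable_cst c : square_integrable (fun=> c).
Proof. exact/square_integrable_bounded/bounded_measurable_cst. Qed.

Lemma square_integrable_integrable f : square_integrable f -> itg f.
Proof.
move=> f2; have := square_integrable_mul f2 (square_integrable_cst 1).
by under [X in integrable _ _ X -> _]eq_fun do rewrite /= mulr1.
Qed.

Lemma square_integrableM f g : bounded_measurable `[0, tf] f ->
  square_integrable g -> square_integrable (fun t => f t * g t).
Proof.
move=> bf [mg gi]; split; first by apply: measurable_funM => //; case: bf.
have bf2 : bounded_measurable `[0, tf] (fun t => f t ^+ 2).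
  exact: (bounded_measurableM bf bf).
under [X in integrable _ _ X]eq_fun do rewrite /= exprMn.
exact: (bounded_measurable_mul_integrable _ bf2).
Qed.

Lemma square_integrableD f g : square_integrable f -> square_integrable g ->
  square_integrable (fun t => f t + g t).
Proof.
move=> f2 g2; split; first by apply: measurable_funD => //; [case: f2|case: g2].
under [X in integrable _ _ X]eq_fun do rewrite /= sqrrD -mulr_natl.
apply: integrable_addr => //; last by case: g2.
apply: integrable_addr => //; first by case: f2.
by apply: integrable_mulrl => //; exact: square_integrable_mul.
Qed.

Lemma square_integrable_sum (I : Type) (r : seq I) (f : I -> R -> R) :
  (forall i, square_integrable (f i)) ->
  square_integrable (fun t => \sum_(i <- r) f i t).
Proof.
move=> f2; elim: r => [|i r IH].
  under eq_fun do rewrite big_nil; exact: square_integrable_cst.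
under eq_fun do rewrite big_cons; exact: square_integrableD.
Qed.

Section Vectors.
Context (m : nat).
Implicit Types (u v w : R -> 'cV[R]_m).

Lemma enorm_sqr (x : 'cV[R]_m) : enorm x ^+ 2 = \sum_i x i 0 ^+ 2.
Proof. by rewrite sqr_sqrtr// sumr_ge0// => i _; exact: sqr_ge0. Qed.

Lemma L2P u : L2 tf u <-> forall i, square_integrable (fun t => u t i 0).
Proof.
have uE : (fun t => enorm (u t) ^+ 2) = (fun t => \sum_i u t i 0 ^+ 2).
  by apply/funext => t; rewrite enorm_sqr.
split=> [[mu_ u2] i|u2].
  split; first exact: mu_.
  have : itg (fun t => enorm (u t) ^+ 2).
    apply/ge0_integrableP => // [|t]; last exact: sqr_ge0.
    rewrite uE; apply: measurable_sum => j; apply: measurable_funX; exact: mu_.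
  apply: le_integrable => //.
    by apply/measurable_EFinP; apply: measurable_funX; exact: mu_.
  move=> t _ /=; rewrite lee_fin !ger0_norm ?sqr_ge0// enorm_sqr (bigD1 i)//=.
  by rewrite lerDl sumr_ge0// => j _; exact: sqr_ge0.
have mu_ : sig_measurable tf u by move=> i; have [] := u2 i.
split=> //; apply/ge0_integrableP => // [|t|].
- rewrite uE; apply: measurable_sum => j; apply: measurable_funX; exact: mu_.
- exact: sqr_ge0.
- by rewrite uE; apply: integrable_sumr => // i; have [] := u2 i.
Qed.

Lemma enorm_sqr_measurable u : sig_measurable tf u ->
  measurable_fun `[0, tf] (fun t => enorm (u t) ^+ 2).
Proof.
move=> mu_; rewrite (_ : (fun t => _) = (fun t => \sum_i u t i 0 ^+ 2)).
  by apply: measurable_sum => i; apply: measurable_funX; exact: mu_.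
by apply/funext => t; rewrite enorm_sqr.
Qed.

Lemma integral_enorm_ae u v : sig_measurable tf u -> sig_measurable tf v ->
  sig_ae tf u v ->
  (\int[mu]_(t in `[0%R, tf]) ((enorm (u t)) ^+ 2)%:E =
   \int[mu]_(t in `[0%R, tf]) ((enorm (v t)) ^+ 2)%:E)%E.
Proof.
move=> mu_ mv uv; apply: ae_eq_integral => //.
- by apply/measurable_EFinP; exact: enorm_sqr_measurable.
- by apply/measurable_EFinP; exact: enorm_sqr_measurable.
by move: uv; apply: ae_imply => t uv; rewrite /= in_itv/= => /uv ->.
Qed.

Lemma L2_sig_measurable u : L2 tf u -> sig_measurable tf u.
Proof. by case. Qed.

Lemma integrable_enorm_sqr u : L2 tf u ->
  mu.-integrable `[0, tf] (EFin \o (fun t => enorm (u t) ^+ 2)).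
Proof.
move=> [mu_ u2]; apply/ge0_integrableP => //; first exact: enorm_sqr_measurable.
by move=> t; exact: sqr_ge0.
Qed.

Lemma L2_ae u v : L2 tf u -> sig_measurable tf v -> sig_ae tf v u -> L2 tf v.
Proof. by move=> [mu_ u2] mv uv; split => //; rewrite (integral_enorm_ae mv mu_ uv). Qed.

Lemma L2norm_ae u v : sig_measurable tf u -> sig_measurable tf v ->
  sig_ae tf u v -> L2norm tf u = L2norm tf v.
Proof. by move=> mu_ mv uv; rewrite /L2norm /Rintegral (integral_enorm_ae mu_ mv uv). Qed.

End Vectors.
End L2Space.

(* From here on L2 is handled through L2P and closure properties only. *)
Opaque L2.
(** The hypothesis says that a quadratic polynomial in x is nonnegative. For
    0 < b it is used at its minimum x = - c / b ^ 2; for b = 0 the polynomial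
    is affine, and 0 < c would make it negative somewhere. *)
Lemma discriminant_le (R : realFieldType) (a b c : R) : 0 <= a -> 0 <= b ->
  (forall x, 0 <= a ^+ 2 + 2 * x * c + x ^+ 2 * b ^+ 2) -> c <= a * b.
Proof.
move=> a0; rewrite le_eqVlt => /predU1P[<-|b0] h; rewrite leNgt; apply/negP.
  rewrite mulr0 => c0; have := h (- (a ^+ 2 + 1) / c).
  rewrite expr0n mulr0 addr0 -mulrA divfK ?gt_eqF//.
  by have := sqr_ge0 a; lra.
move=> abc; have ab0 := mulr_ge0 a0 (ltW b0); have c0 := le_lt_trans ab0 abc.
have : (a * b) ^+ 2 < c ^+ 2 by rewrite ltr_pXn2r// nnegrE ?ltW.
have := h (- c / b ^+ 2).
rewrite (_ : _ + _ = a ^+ 2 - c ^+ 2 / b ^+ 2); last by field; rewrite gt_eqF.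
by rewrite subr_ge0 ler_pdivrMr ?exprn_gt0// exprMn => ? ?; lra.
Qed.

Section L2InnerProduct.
Context (R : realType) (tf : R) (m : nat).
Notation mu := (@lebesgue_measure R).
Notation itg f := (mu.-integrable `[0, tf] (EFin \o f)).
Implicit Types (u v w : R -> 'cV[R]_m).

(** The L2 inner product, as a sum over components so that scalar integration
    theorems apply directly. *)
Definition ip u v : R := \sum_i \int[mu]_(t in `[0, tf]) (u t i 0 * v t i 0).

Definition eq_on p (u v : R -> 'cV[R]_p) := forall t, 0 <= t <= tf -> u t = v t.

Lemma L2D u v : L2 tf u -> L2 tf v -> L2 tf (fun t => u t + v t).
Proof.
move=> /L2P u2 /L2P v2; apply/L2P => i; under eq_fun do rewrite mxE.
exact: square_integrableD.
Qed.

Lemma L2Z c u : L2 tf u -> L2 tf (fun t => c *: u t).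
Proof.
move=> /L2P u2; apply/L2P => i; under eq_fun do rewrite mxE.
by apply: square_integrableM => //; exact: bounded_measurable_cst.
Qed.

Lemma L2B u v : L2 tf u -> L2 tf v -> L2 tf (fun t => u t - v t).
Proof.
move=> u2 /(L2Z (-1)) v2; have := L2D u2 v2.
by under [X in L2 _ X -> _]eq_fun do rewrite scaleN1r.
Qed.

Lemma L2_mul_integrable u v i : L2 tf u -> L2 tf v ->
  itg (fun t => u t i 0 * v t i 0).
Proof. by move=> /L2P u2 /L2P v2; exact: square_integrable_mul. Qed.

Lemma ip_eq_on u u' v v' : eq_on u u' -> eq_on v v' -> ip u v = ip u' v'.
Proof.
move=> uu' vv'; apply: eq_bigr => i _; apply: eq_Rintegral => t.
by rewrite inE/= in_itv/= => tI; rewrite uu' ?vv'.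
Qed.

Lemma ipC u v : ip u v = ip v u.
Proof. by apply: eq_bigr => i _; apply: eq_Rintegral => t _; rewrite mulrC. Qed.

Lemma ipDl u v w : L2 tf u -> L2 tf v -> L2 tf w ->
  ip (fun t => u t + v t) w = ip u w + ip v w.
Proof.
move=> u2 v2 w2; rewrite -big_split; apply: eq_bigr => i _/=.
rewrite -RintegralD//; try exact: L2_mul_integrable.
by apply: eq_Rintegral => t _; rewrite mxE mulrDl.
Qed.

Lemma ipZl c u v : L2 tf u -> L2 tf v -> ip (fun t => c *: u t) v = c * ip u v.
Proof.
move=> u2 v2; rewrite mulr_sumr; apply: eq_bigr => i _/=.
rewrite -RintegralZl//; last exact: L2_mul_integrable.
by apply: eq_Rintegral => t _; rewrite mxE mulrA.
Qed.

Lemma ipDr u v w : L2 tf u -> L2 tf v -> L2 tf w ->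
  ip w (fun t => u t + v t) = ip w u + ip w v.
Proof. by move=> u2 v2 w2; rewrite ipC ipDl// !(ipC w). Qed.

Lemma ipZr c u v : L2 tf u -> L2 tf v -> ip u (fun t => c *: v t) = c * ip u v.
Proof. by move=> u2 v2; rewrite ipC ipZl// (ipC u). Qed.

Lemma ipE u v : L2 tf u -> L2 tf v ->
  ip u v = \int[mu]_(t in `[0, tf]) ((u t)^T *m v t) 0 0.
Proof.
move=> u2 v2; rewrite /ip -Rintegral_sum// => [|i]; last exact: L2_mul_integrable.
apply: eq_Rintegral => t _; rewrite mxE; apply: eq_bigr => i _; by rewrite mxE.
Qed.

Lemma integrable_dot u v : L2 tf u -> L2 tf v ->
  itg (fun t => ((u t)^T *m v t) 0 0).
Proof.
move=> u2 v2; rewrite (_ : (fun t => _) = fun t => \sum_i (u t i 0 * v t i 0)).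
  by apply: integrable_sumr => // i; exact: L2_mul_integrable.
by apply/funext => t; rewrite mxE; apply: eq_bigr => i _; rewrite mxE.
Qed.

Lemma L2norm_sqr u : L2 tf u -> L2norm tf u ^+ 2 = ip u u.
Proof.
move=> u2; rewrite sqr_sqrtr; last first.
  by apply: Rintegral_ge0 => t _; exact: sqr_ge0.
rewrite ipE//; apply: eq_Rintegral => t _; rewrite enorm_sqr mxE.
by apply: eq_bigr => i _; rewrite mxE expr2.
Qed.

Lemma L2norm_ge0 u : 0 <= L2norm tf u.
Proof. exact: sqrtr_ge0. Qed.

Lemma ip_ge0 u : L2 tf u -> 0 <= ip u u.
Proof. by move=> u2; rewrite -L2norm_sqr// sqr_ge0. Qed.

Lemma L2norm_ip u : L2 tf u -> L2norm tf u = Num.sqrt (ip u u).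
Proof.
by move=> u2; rewrite -L2norm_sqr// sqrtr_sqr ger0_norm// L2norm_ge0.
Qed.

Lemma L2normZ c u : L2 tf u -> L2norm tf (fun t => c *: u t) = `|c| * L2norm tf u.
Proof.
move=> u2; rewrite !L2norm_ip//; last exact: L2Z.
rewrite (ipZl c u2 (L2Z c u2)) (ipZr c u2 u2).
by rewrite mulrA -expr2 sqrtrM ?sqr_ge0// sqrtr_sqr.
Qed.

(** The discriminant argument, applied to the squared norm of u + x v. *)
Lemma Cauchy_Schwarz u v : L2 tf u -> L2 tf v ->
  ip u v <= L2norm tf u * L2norm tf v.
Proof.
move=> u2 v2; have h x : 0 <= ip u u + 2 * x * ip u v + x ^+ 2 * ip v v.
  have xv2 := L2Z x v2; have := ip_ge0 (L2D u2 xv2).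
  rewrite (ipDl u2 xv2 (L2D u2 xv2)) (ipDr u2 xv2 u2) (ipDr u2 xv2 xv2).
  rewrite (ipZl x v2 u2) (ipZl x v2 xv2) (ipZr x u2 v2) (ipZr x v2 v2) (ipC v u).
  by move: (ip _ _) (ip _ _) (ip _ _) => *; lra.
have u0 := L2norm_ge0 u; have v0 := L2norm_ge0 v.
by rewrite -!L2norm_sqr// in h; exact: discriminant_le h.
Qed.

Lemma ler_L2normD u v : L2 tf u -> L2 tf v ->
  L2norm tf (fun t => u t + v t) <= L2norm tf u + L2norm tf v.
Proof.
move=> u2 v2; have uv2 := L2D u2 v2.
rewrite -(ler_pXn2r (n := 2)) ?nnegrE ?addr_ge0 ?L2norm_ge0//.
rewrite (L2norm_sqr uv2) (ipDl u2 v2 uv2) (ipDr u2 v2 u2) (ipDr u2 v2 v2) (ipC v u).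
rewrite sqrrD -(L2norm_sqr u2) -(L2norm_sqr v2).
have := Cauchy_Schwarz u2 v2; move: (ip u v) (_ * _) (_ ^+ 2) (_ ^+ 2) => *; lra.
Qed.

End L2InnerProduct.

(** * Completeness *)

Section AlmostEverywhereLimits.
Context d (T : measurableType d) (R : realType).
Context (mu : {measure set T -> \bar R}) (D : set T) (mD : measurable D).
Implicit Types (f : nat -> T -> R).

Lemma summable_cvg (u : nat -> R) :
  (\sum_(0 <= k <oo) `|u k|%:E < +oo)%E -> cvgn (series u).
Proof.
move=> uoo; apply: normed_cvg; apply: nondecreasing_is_cvgn.
  apply/nondecreasing_seqP => n; rewrite /normed_series_of /series/= big_nat_recr//= lerDl.
  exact: normr_ge0.
have fin : (\sum_(0 <= k <oo) `|u k|%:E)%E \is a fin_num.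
  by rewrite ge0_fin_numE// nneseries_ge0.
exists (fine (\sum_(0 <= k <oo) `|u k|%:E)%E) => _ [n _ <-].
rewrite -lee_fin fineK// /normed_series_of /series/= -sumEFin.
by apply: nneseries_lim_ge => k _ _; rewrite lee_fin.
Qed.

(** If consecutive differences have geometrically decreasing L1 norms, their
    sum of absolute values is integrable, hence finite almost everywhere, and
    the telescoping series converges there. *)
Lemma ae_cvg_geometric f (K q : R) : 0 <= q < 1 ->
  (forall k, measurable_fun D (f k)) ->
  (forall k, (\int[mu]_(x in D) `|f k.+1 x - f k x|%:E <= (K * q ^+ k)%:E)%E) ->
  exists2 g : T -> R, measurable_fun D g &
    {ae mu, forall x, D x -> f n x @[n --> \oo] --> g x}.
Proof.
move=> /andP[q0 q1] mf fK.
pose df k x : R := f k.+1 x - f k x.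
have mdf k : measurable_fun D (EFin \o (fun x => `|df k x|)).
  apply/measurable_EFinP; apply: measurableT_comp => //; exact: measurable_funB.
pose S x := (\sum_(0 <= k <oo) `|df k x|%:E)%E.
have S0 x : (0 <= S x)%E by apply: nneseries_ge0 => k _ _; rewrite lee_fin.
have iS : mu.-integrable D S.
  apply/integrableP; split.
    apply: (@ge0_emeasurable_sum _ _ _ D (fun k x => `|df k x|%:E) xpredT).
      by move=> k x _ _; rewrite lee_fin.
    by move=> k _; exact: mdf.
  under eq_integral do rewrite gee0_abs//.
  rewrite integral_nneseries//.
  apply: (@le_lt_trans _ _ (\sum_(0 <= k <oo) (K * q ^+ k)%:E)%E).
    apply: lee_nneseries => [k _ _|k _]; last exact: fK.
    by apply: integral_ge0 => x _; rewrite lee_fin.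
  have cK : series (fun k => K * q ^+ k) @ \oo --> K / (1 - q).
    have := @cvg_geometric_series _ K q; rewrite ger0_norm// => /(_ q1).
    exact.
  rewrite (_ : (\sum_(0 <= k <oo) _)%E = (K / (1 - q))%:E) ?ltry//.
  apply/cvg_lim => //.
  rewrite (_ : (fun n => _) = EFin \o series (fun k => K * q ^+ k)); last first.
    by apply/funext => n /=; rewrite /series/= sumEFin.
  by apply: cvg_EFin cK; exact: nearW.
exists (fun x => fine (limn_esup (fun n => (f n x)%:E))).
  apply: measurableT_comp => //; apply: measurable_fun_limn_esup => n.
  exact/measurable_EFinP.
apply: filterS (integrable_ae mD iS) => x Sx Dx.
have {Sx} : (S x < +oo)%E by rewrite -ge0_fin_numE// Sx.
move=> /summable_cvg/cvg_ex[/= l dl].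
have fl : f n x @[n --> \oo] --> f 0%N x + l.
  rewrite (_ : (fun n => f n x) = (fun n => f 0%N x + series (df ^~ x) n)).
    by apply: cvgD dl; exact: cvg_cst.
  by apply/funext => n; rewrite /series/= telescope_sumr// addrC subrK.
suff -> : limn_esup (fun n => (f n x)%:E) = (f 0%N x + l)%:E by [].
by apply: (cvg_limn_einf_sup _).2; apply: cvg_EFin fl; exact: nearW.
Qed.

Lemma limn_einf_le_bound (u : nat -> \bar R) (M : \bar R) :
  (forall n, (u n <= M)%E) -> (limn_einf u <= M)%E.
Proof.
move=> uM; rewrite limn_einf_lim; apply: lime_le; first exact: is_cvg_einfs.
apply: nearW => n; apply: le_trans (uM n); apply: ereal_inf_lbound.
by exists n => /=.
Qed.

(** The L2 distance to a fixed h is lower semicontinuous for almost everywhere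
    convergence. *)
Lemma fatou_sqr f (g h : T -> R) (M : R) :
  (forall k, measurable_fun D (f k)) -> measurable_fun D g -> measurable_fun D h ->
  {ae mu, forall x, D x -> f n x @[n --> \oo] --> g x} ->
  (forall k, (\int[mu]_(x in D) ((f k x - h x) ^+ 2)%:E <= M%:E)%E) ->
  (\int[mu]_(x in D) ((g x - h x) ^+ 2)%:E <= M%:E)%E.
Proof.
move=> mf mg mh fg fM.
have msq (p : T -> R) : measurable_fun D p ->
    measurable_fun D (fun x => ((p x - h x) ^+ 2)%:E).
  by move=> mp; apply/measurable_EFinP; apply: measurable_funX; exact: measurable_funB.
rewrite (@ae_eq_integral _ _ _ _ _
    (fun x => limn_einf (fun k => ((f k x - h x) ^+ 2)%:E)))//; last 3 first.
- exact: msq.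
- rewrite /limn_einf; apply: measurableT_comp => //.
  apply: measurable_fun_limn_esup => k; apply: measurableT_comp => //; exact: msq.
- apply: filterS fg => x fg Dx; apply/esym/(cvg_limn_einf_sup _).1.
  apply: cvg_EFin; [exact: nearW|rewrite expr2].
  by apply: cvgM; apply: cvgB; [exact: fg|exact: cvg_cst|exact: fg|exact: cvg_cst].
apply: le_trans (fatou _ _ _ _) _ => //.
- by move=> k; exact: msq.
- by move=> k x _; rewrite lee_fin sqr_ge0.
exact: limn_einf_le_bound.
Qed.

End AlmostEverywhereLimits.

Section L2Completeness.
Context (R : realType) (tf : R) (m : nat).
Notation mu := (@lebesgue_measure R).
Notation itg f := (mu.-integrable `[0, tf] (EFin \o f)).
Implicit Types (u v w : R -> 'cV[R]_m).

Lemma ler_component_L2norm u i : L2 tf u ->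
  \int[mu]_(t in `[0, tf]) (u t i 0 ^+ 2) <= L2norm tf u ^+ 2.
Proof.
move=> u2; rewrite L2norm_sqr// /ip (bigD1 i)//=.
under eq_Rintegral do rewrite expr2.
rewrite lerDl sumr_ge0// => j _; apply: Rintegral_ge0 => t _.
by rewrite -expr2 sqr_ge0.
Qed.

Lemma L2norm_geometric (u : nat -> R -> 'cV[R]_m) (c q : R) :
  0 < q < 1 -> (forall k, L2 tf (u k)) ->
  (forall k, L2norm tf (fun t => u k.+1 t - u k t) <= c * q ^+ k) ->
  forall k n, L2norm tf (fun t => u (k + n)%N t - u k t) <=
    c * q ^+ k * ((1 - q ^+ n) / (1 - q)).
Proof.
move=> /andP[q0 q1] u2 uq k; elim=> [|n IH].
  rewrite addn0 expr0 subrr mul0r mulr0 (_ : (fun t => _) = fun t => 0 *: u k t).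
    by rewrite L2normZ// normr0 mul0r.
  by apply/funext => t; rewrite subrr scale0r.
have -> : (fun t => u (k + n.+1)%N t - u k t) =
    (fun t => (u (k + n).+1 t - u (k + n)%N t) + (u (k + n)%N t - u k t)).
  by apply/funext => t; rewrite addnS addrA subrK.
apply: le_trans (ler_L2normD (L2B (u2 _) (u2 _)) (L2B (u2 _) (u2 _))) _.
apply: le_trans (lerD (uq _) IH) _.
rewrite exprD [leRHS](_ : _ = c * (q ^+ k * q ^+ n) +
  c * q ^+ k * ((1 - q ^+ n) / (1 - q)))//.
by rewrite exprS; field; rewrite subr_eq0 gt_eqF.
Qed.

Lemma L2norm_le_component u (K : R) : 0 <= K -> L2 tf u ->
  (forall i, \int[mu]_(t in `[0, tf]) (u t i 0 ^+ 2) <= K ^+ 2) ->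
  L2norm tf u <= Num.sqrt m%:R * K.
Proof.
move=> K0 u2 uK.
rewrite -(ler_pXn2r (n := 2)) ?nnegrE ?L2norm_ge0 ?(mulr_ge0 (sqrtr_ge0 _) K0)//.
rewrite L2norm_sqr// exprMn sqr_sqrtr// /ip.
apply: (@le_trans _ _ (\sum_(i < m) K ^+ 2)); last first.
  by rewrite sumr_const card_ord mulr_natl.
apply: ler_sum => i _; apply: le_trans (uK i).
by under eq_Rintegral do rewrite -expr2.
Qed.

(** L2 is complete: a fast Cauchy sequence converges almost everywhere
    componentwise, and Fatou's lemma bounds the distance to the limit. *)
Lemma L2_complete (u : nat -> R -> 'cV[R]_m) (c q : R) :
  0 < tf -> 0 < q < 1 -> (forall k, L2 tf (u k)) ->
  (forall k, L2norm tf (fun t => u k.+1 t - u k t) <= c * q ^+ k) ->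
  exists2 v, L2 tf v &
    (fun k => L2norm tf (fun t => u k t - v t)) @ \oo --> (0 : R).
Proof.
move=> tf0 q01 u2 uq; have /andP[q0 q1] := q01.
have c0 : 0 <= c.
  by have := uq 0%N; rewrite expr0 mulr1; apply: le_trans; exact: L2norm_ge0.
have u2' k n : L2 tf (fun t => u n t - u k t) by exact: L2B.
have mui i k : measurable_fun `[0, tf] (fun t => u k t i 0).
  by have /L2P/(_ i)[] := u2 k.
have dint i k : (\int[mu]_(t in `[0%R, tf]) `|u k.+1 t i 0 - u k t i 0|%:E <=
    (((tf + c ^+ 2) / 2) * q ^+ k)%:E)%E.
  have /L2P/(_ i) d2 := u2' k k.+1.
  have dE : (fun t => (u k.+1 t - u k t) i 0) = (fun t => u k.+1 t i 0 - u k t i 0).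
    by apply/funext => t; rewrite !mxE.
  rewrite dE in d2; have id := square_integrable_integrable d2.
  have ind : itg (fun t => `|u k.+1 t i 0 - u k t i 0|) by exact: integrable_norm id.
  rewrite -EFin_Rintegral// lee_fin.
  have i1 : itg (fun=> q ^+ k / 2).
    by apply: square_integrable_integrable; exact: square_integrable_cst.
  have i2 : itg (fun t => (q ^+ k)^-1 / 2 * (u k.+1 t i 0 - u k t i 0) ^+ 2).
    by apply: integrable_mulrl => //; case: d2.
  (* |x| <= q^k / 2 + x^2 / (2 q^k) turns the geometric decay of the L2 norms
     into one of the L1 norms. *)
  apply: (@le_trans _ _ (\int[mu]_(t in `[0, tf]) (q ^+ k / 2 +
      (q ^+ k)^-1 / 2 * (u k.+1 t i 0 - u k t i 0) ^+ 2))).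
    apply: le_Rintegral => //; first exact: integrable_addr.
    move=> t _; set x := _ - _.
    rewrite -subr_ge0 -(real_normK (num_real x)) [leRHS](_ : _ =
      (q ^+ k - `|x|) ^+ 2 / (2 * q ^+ k)); last by field; rewrite expf_neq0 ?gt_eqF.
    by rewrite divr_ge0 ?sqr_ge0// mulr_ge0// exprn_ge0// ltW.
  rewrite RintegralD// Rintegral_cst// RintegralZl//; last by case: d2.
  rewrite /= lebesgue_measure_itv/= lte_fin tf0/= subr0.
  have := ler_component_L2norm i (u2' k k.+1).
  under eq_Rintegral do rewrite !mxE.
  have cq0 : 0 <= c * q ^+ k by rewrite mulr_ge0// exprn_ge0// ltW.
  have h1 : L2norm tf (fun t => u k.+1 t - u k t) ^+ 2 <= (c * q ^+ k) ^+ 2.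
    by rewrite ler_pXn2r ?nnegrE ?L2norm_ge0// uq.
  move=> h2; have := le_trans h2 h1; set I := Rintegral _ _ _ => hI.
  have -> : (tf + c ^+ 2) / 2 * q ^+ k =
      q ^+ k / 2 * tf + (q ^+ k)^-1 / 2 * (c * q ^+ k) ^+ 2.
    by field; rewrite expf_neq0 ?gt_eqF.
  by rewrite lerD2l ler_wpM2l// divr_ge0// invr_ge0 exprn_ge0// ltW.
have /choice[g hg] : forall i, exists g : R -> R, measurable_fun `[0, tf] g /\
    {ae mu, forall t, `[0, tf]%classic t -> u n t i 0 @[n --> \oo] --> g t}.
  have q01' : 0 <= q < 1 by rewrite ltW.
  have mD : measurable (`[0, tf]%classic : set (measurableTypeR R)) by [].
  move=> i; have [g mg ug] := ae_cvg_geometric mD q01' (mui i) (dint i).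
  by exists g.
pose v t : 'cV[R]_m := \col_i g i t.
pose M k := c * q ^+ k / (1 - q).
have M0 k : 0 <= M k by rewrite divr_ge0 ?mulr_ge0 ?exprn_ge0 ?subr_ge0// ltW.
have fat i k : (\int[mu]_(t in `[0%R, tf]) ((g i t - u k t i 0) ^+ 2)%:E <= (M k ^+ 2)%:E)%E.
  apply: (@fatou_sqr _ _ _ mu `[0, tf] _ (fun n t => u (k + n)%N t i 0)) => //.
  - by move=> n; exact: mui.
  - by have [] := hg i.
  - exact: mui.
  - have [_] := hg i; apply: ae_imply => t ut /ut.
    by rewrite -(cvg_shiftn k); under eq_fun do rewrite addnC.
  - move=> n; have /L2P/(_ i)[_] := u2' k (k + n)%N.
    under [X in integrable _ _ X]eq_fun do rewrite /= !mxE.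
    move=> ii; rewrite -EFin_Rintegral// lee_fin.
    have := ler_component_L2norm i (u2' k (k + n)%N).
    under eq_Rintegral do rewrite !mxE.
    move=> /le_trans; apply; rewrite ler_pXn2r ?nnegrE ?L2norm_ge0//.
    apply: le_trans (L2norm_geometric q01 u2 uq k n) _.
    rewrite /M ler_wpM2l ?mulr_ge0 ?exprn_ge0 ?(ltW q0)//.
    rewrite -[leRHS]mul1r ler_wpM2r ?invr_ge0 ?subr_ge0 ?(ltW q1)//.
    by rewrite gerBl exprn_ge0// ltW.
have vu2 k : L2 tf (fun t => v t - u k t).
  apply/L2P => i; under eq_fun do rewrite !mxE.
  have mgu : measurable_fun `[0, tf] (fun t => g i t - u k t i 0).
    by apply: measurable_funB => //; have [] := hg i.
  split => //; apply/ge0_integrableP => //; first exact: measurable_funX.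
    by move=> t; exact: sqr_ge0.
  by apply: le_lt_trans (fat i k) _; exact: ltry.
have v2 : L2 tf v.
  have := L2D (vu2 0%N) (u2 0%N).
  by under [X in L2 _ X -> _]eq_fun do rewrite subrK.
exists v => //.
have Mk k : L2norm tf (fun t => u k t - v t) <= Num.sqrt m%:R * M k.
  rewrite (_ : (fun t => _) = fun t => (-1) *: (v t - u k t)); last first.
    by apply/funext => t; rewrite scaleN1r opprB.
  rewrite L2normZ// normrN1 mul1r.
  apply: L2norm_le_component => // i; have := fat i k.
  under eq_Rintegral do rewrite !mxE.
  move=> h; rewrite -lee_fin EFin_Rintegral//.
  by have /L2P/(_ i)[_] := vu2 k; under [X in integrable _ _ X]eq_fun do rewrite /= !mxE.
have near0 : \forall k \near \oo, 0 <= L2norm tf (fun t => u k t - v t) <=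
    Num.sqrt m%:R * M k.
  by apply: nearW => n; rewrite L2norm_ge0 Mk.
apply: (squeeze_cvgr near0); first exact: cvg_cst.
rewrite -(mulr0 (Num.sqrt m%:R)); apply: cvgM; first exact: cvg_cst.
rewrite (_ : M = fun k => (c / (1 - q)) * q ^+ k); last first.
  by apply/funext => k; rewrite /M mulrAC.
rewrite -(mulr0 (c / (1 - q))); apply: cvgM; first exact: cvg_cst.
by apply: cvg_expr; rewrite ger0_norm// ltW.
Qed.

End L2Completeness.

Section L2AlmostEverywhere.
Context (R : realType) (tf : R) (m : nat).
Notation mu := (@lebesgue_measure R).
Implicit Types (u v w : R -> 'cV[R]_m).

Lemma L2norm0_ae u : L2 tf u -> L2norm tf u = 0 -> sig_ae tf u (fun=> 0).
Proof.
move=> u2 u0; have mu_ := L2_sig_measurable u2; have iu := integrable_enorm_sqr u2.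
have mE : measurable_fun `[0, tf] (EFin \o (fun t => enorm (u t) ^+ 2)).
  by apply/measurable_EFinP; exact: enorm_sqr_measurable.
have : (\int[mu]_(t in `[0%R, tf]) `|(enorm (u t) ^+ 2)%:E| = 0)%E.
  under eq_integral do rewrite gee0_abs ?lee_fin ?sqr_ge0//.
  rewrite -EFin_Rintegral//; congr EFin.
  apply/eqP; rewrite eq_le Rintegral_ge0 ?andbT => [|t _]; last exact: sqr_ge0.
  by rewrite -sqrtr_eq0; apply/eqP.
have mD : measurable (`[0, tf]%classic : set (measurableTypeR R)) by [].
move=> /(ae_eq_integral_abs mu mD mE).1.
apply: ae_imply => t; rewrite /= in_itv/= => ut /ut [].
rewrite enorm_sqr => /eqP; rewrite psumr_eq0 => [/allP ui|i _]; last exact: sqr_ge0.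
apply/matrixP => i j; rewrite ord1 mxE; apply/eqP.
by have := ui i (mem_index_enum _); rewrite sqrf_eq0.
Qed.

Lemma L2norm_eq_on u v : eq_on tf u v -> L2norm tf u = L2norm tf v.
Proof.
move=> uv; congr Num.sqrt; apply: eq_Rintegral => t.
by rewrite inE/= in_itv/= => /uv ->.
Qed.

Lemma L2_eq_on u v : eq_on tf u v -> L2 tf u -> L2 tf v.
Proof.
move=> uv /L2P u2; apply/L2P => i; have [mui i2] := u2 i.
have uvi t : t \in (`[0, tf]%classic : set R) -> u t i 0 = v t i 0.
  by rewrite inE/= in_itv/= => /uv ->.
split; first exact: eq_measurable_fun mui.
by apply: eq_integrable i2 => // t /uvi /= ->.
Qed.

End L2AlmostEverywhere.

(** * Multipliers and running integrals on signals *)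

Section MatrixMultipliers.
Context (R : realType) (tf : R).

Definition bounded_measurable_mx p q (M : R -> 'M[R]_(p, q)) : Prop :=
  forall i j, bounded_measurable `[0, tf] (fun t => M t i j).

Definition mulsig p q (M : R -> 'M[R]_(p, q)) (u : R -> 'cV[R]_q) : R -> 'cV[R]_p :=
  fun t => M t *m u t.

Definition bounded_op p q (K : (R -> 'cV[R]_p) -> R -> 'cV[R]_q) : Prop :=
  (forall u, L2 tf u -> L2 tf (K u)) /\
  exists2 c, 0 <= c & forall u, L2 tf u -> L2norm tf (K u) <= c * L2norm tf u.

Lemma bounded_measurable_mx_cst p q (M : 'M[R]_(p, q)) :
  bounded_measurable_mx (fun=> M).
Proof. by move=> i j; exact: bounded_measurable_cst. Qed.

Lemma bounded_measurable_mx_mul p q r (M : R -> 'M[R]_(p, q)) (N : R -> 'M[R]_(q, r)) :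
  bounded_measurable_mx M -> bounded_measurable_mx N ->
  bounded_measurable_mx (fun t => M t *m N t).
Proof.
move=> bM bN i j.
rewrite (_ : (fun t => _) = (fun t => \sum_k M t i k * N t k j)); last first.
  by apply/funext => t; rewrite mxE.
by apply: bounded_measurable_sum => k; exact: bounded_measurableM.
Qed.

Lemma bounded_measurable_mx_tr p q (M : R -> 'M[R]_(p, q)) :
  bounded_measurable_mx M -> bounded_measurable_mx (fun t => (M t)^T).
Proof.
move=> bM i j; rewrite (_ : (fun t => _) = (fun t => M t j i)) //.
by apply/funext => t; rewrite mxE.
Qed.

Lemma continuous_expmx n (A : 'M[R]_n) i j : continuous (fun t : R => expmx (t *: A) i j).
Proof.
move=> x; apply: differentiable_continuous; apply/derivable1_diffP.
by have [] := is_derive_expmx A x i j.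
Qed.

Lemma continuous_expmxN n (A : 'M[R]_n) i j :
  continuous (fun t : R => expmx ((- t) *: A) i j).
Proof.
move=> x; apply: differentiable_continuous; apply/derivable1_diffP.
by have [] := is_derive_expmxN A x i j.
Qed.

Lemma bounded_measurable_mx_expmx n (A : 'M[R]_n) :
  bounded_measurable_mx (fun t => expmx (t *: A)).
Proof. by move=> i j; apply: continuous_bounded_measurable; exact: continuous_expmx. Qed.

Lemma bounded_measurable_mx_expmxN n (A : 'M[R]_n) :
  bounded_measurable_mx (fun t => expmx ((- t) *: A)).
Proof. by move=> i j; apply: continuous_bounded_measurable; exact: continuous_expmxN. Qed.

Lemma L2_mulsig p q (M : R -> 'M[R]_(p, q)) u :
  bounded_measurable_mx M -> L2 tf u -> L2 tf (mulsig M u).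
Proof.
move=> bM /L2P u2; apply/L2P => i; under eq_fun do rewrite mxE.
by apply: square_integrable_sum => k; exact: square_integrableM.
Qed.

Lemma ip_mulsig p q (M : R -> 'M[R]_(p, q)) u v :
  bounded_measurable_mx M -> L2 tf u -> L2 tf v ->
  ip tf (mulsig M u) v = ip tf u (mulsig (fun t => (M t)^T) v).
Proof.
move=> bM u2 v2; have bMt := bounded_measurable_mx_tr bM.
rewrite (ipE (L2_mulsig bM u2) v2) (ipE u2 (L2_mulsig bMt v2)).
by apply: eq_Rintegral => t _; rewrite /mulsig trmx_mul mulmxA.
Qed.

Lemma ler_enorm m (x : 'cV[R]_m) i : `|x i 0| <= enorm x.
Proof.
rewrite -(ler_pXn2r (n := 2)) ?nnegrE ?sqrtr_ge0// enorm_sqr real_normK ?num_real//.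
by rewrite (bigD1 i)//= lerDl sumr_ge0// => j _; exact: sqr_ge0.
Qed.

Lemma bounded_op_mulsig p q (M : R -> 'M[R]_(p, q)) :
  bounded_measurable_mx M -> bounded_op (mulsig M).
Proof.
move=> bM; split=> [u|]; first exact: L2_mulsig.
have /choice[b hb] : forall ij : 'I_p * 'I_q, exists b, forall t,
    `[0, tf]%classic t -> `|M t ij.1 ij.2| <= b.
  by move=> [i j]; have [_ [b hb]] := bM i j; exists b.
pose K := \sum_i \sum_j `|b (i, j)|.
have K0 : 0 <= K by apply: sumr_ge0 => i _; apply: sumr_ge0.
exists (Num.sqrt p%:R * K); first by rewrite mulr_ge0// sqrtr_ge0.
move=> u u2; rewrite -mulrA; apply: L2norm_le_component => [||i].
- by rewrite mulr_ge0// L2norm_ge0.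
- exact: L2_mulsig.
have /L2P/(_ i)[_ iMu] := L2_mulsig bM u2.
have iu := integrable_enorm_sqr u2.
rewrite exprMn sqr_sqrtr; last by apply: Rintegral_ge0 => t _; exact: sqr_ge0.
rewrite -RintegralZl//; apply: le_Rintegral => //; first exact: integrable_mulrl.
move=> t tI; rewrite -exprMn -[leLHS]real_normK ?num_real//.
rewrite ler_pXn2r ?nnegrE ?mulr_ge0 ?sqrtr_ge0//.
rewrite mxE; apply: le_trans (ler_norm_sum _ _ _) _.
apply: (@le_trans _ _ (\sum_j `|b (i, j)| * enorm (u t))).
  apply: ler_sum => j _; rewrite normrM ler_pM ?ler_enorm//.
  by apply: le_trans (hb (i, j) t tI) _; exact: ler_norm.
rewrite -mulr_suml ler_wpM2r ?sqrtr_ge0//.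
rewrite /K (bigD1 i)//= lerDl.
by apply: sumr_ge0 => k _; apply: sumr_ge0.
Qed.

Lemma bounded_op_comp p q r (K : (R -> 'cV[R]_q) -> R -> 'cV[R]_r)
    (L : (R -> 'cV[R]_p) -> R -> 'cV[R]_q) :
  bounded_op K -> bounded_op L -> bounded_op (fun u => K (L u)).
Proof.
move=> [K2 [c c0 Kc]] [L2' [d d0 Ld]]; split=> [u /L2' /K2//|].
exists (c * d); first exact: mulr_ge0.
move=> u u2; apply: le_trans (Kc _ (L2' _ u2)) _.
by rewrite -mulrA ler_wpM2l// Ld.
Qed.

Lemma bounded_opD p q (K L : (R -> 'cV[R]_p) -> R -> 'cV[R]_q) :
  bounded_op K -> bounded_op L -> bounded_op (fun u t => K u t + L u t).
Proof.
move=> [K2 [c c0 Kc]] [L2' [d d0 Ld]]; split=> [u u2|].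
  exact: (@L2D _ _ _ (K u) (L u) (K2 _ u2) (L2' _ u2)).
exists (c + d); first exact: addr_ge0.
move=> u u2; have h := @ler_L2normD _ tf _ (K u) (L u) (K2 _ u2) (L2' _ u2).
apply: (le_trans h).
by rewrite mulrDl; apply: lerD; [exact: Kc|exact: Ld].
Qed.

Lemma bounded_op_eq_on p q (K L : (R -> 'cV[R]_p) -> R -> 'cV[R]_q) :
  (forall u, L2 tf u -> eq_on tf (K u) (L u)) -> bounded_op K -> bounded_op L.
Proof.
move=> KL [K2 [c c0 Kc]]; split=> [u u2|]; first exact: L2_eq_on (KL _ u2) (K2 _ u2).
by exists c => // u u2; rewrite -(L2norm_eq_on (KL _ u2)) Kc.
Qed.

End MatrixMultipliers.

Section VectorVolterra.
Context (R : realType) (tf : R) (htf : 0 < tf).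
Notation mu := (@lebesgue_measure R).
Notation itg f := (mu.-integrable `[0, tf] (EFin \o f)).

Definition integrable_sig (s t : R) m (a : R -> 'cV[R]_m) : Prop :=
  forall i, mu.-integrable `[s, t] (EFin \o (fun r => a r i 0)).

Lemma L2_integrable_sig m (a : R -> 'cV[R]_m) s t : 0 <= s -> t <= tf ->
  L2 tf a -> integrable_sig s t a.
Proof.
move=> s0 ttf /L2P a2 i; apply: integrable_subitv s0 ttf _.
exact: square_integrable_integrable.
Qed.

Lemma eq_vint m (a b : R -> 'cV[R]_m) (s t : R) :
  (forall r, s <= r <= t -> a r = b r) -> vint s t a = vint s t b.
Proof.
move=> ab; apply/matrixP => i j; rewrite !mxE; apply: eq_Rintegral => r.
by rewrite inE/= in_itv/= => /ab ->.
Qed.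

Lemma vint_mulmx p q (M : 'M[R]_(p, q)) (a : R -> 'cV[R]_q) s t :
  integrable_sig s t a -> vint s t (fun r => M *m a r) = M *m vint s t a.
Proof.
move=> ia; apply/matrixP => i j; rewrite !mxE.
under eq_Rintegral do rewrite mxE.
rewrite Rintegral_sum// => [|k]; last exact: integrable_mulrl.
by apply: eq_bigr => k _; rewrite RintegralZl// mxE.
Qed.

Lemma vintD m (a b : R -> 'cV[R]_m) s t :
  integrable_sig s t a -> integrable_sig s t b ->
  vint s t (fun r => a r + b r) = vint s t a + vint s t b.
Proof.
move=> ia ib; apply/matrixP => i j; rewrite !mxE.
by under eq_Rintegral do rewrite mxE; rewrite RintegralD.
Qed.

Lemma vintZ m c (a : R -> 'cV[R]_m) s t : integrable_sig s t a ->
  vint s t (fun r => c *: a r) = c *: vint s t a.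
Proof.
move=> ia; apply/matrixP => i j; rewrite !mxE.
by under eq_Rintegral do rewrite mxE; rewrite RintegralZl.
Qed.

Definition volterra m (a : R -> 'cV[R]_m) : R -> 'cV[R]_m := fun t => vint 0 t a.

Definition volterra_adj m (a : R -> 'cV[R]_m) : R -> 'cV[R]_m :=
  fun t => vint t tf a.

Lemma volterra_continuous m (a : R -> 'cV[R]_m) i : integrable_sig 0 tf a ->
  {within `[0, tf], continuous (fun t => volterra a t i 0)}.
Proof.
move=> ia; rewrite (_ : (fun t => _) = (fun t => \int[mu]_(r in `[0, t]) a r i 0)).
  exact: parameterized_integral_continuous (ltW htf) (ia i).
by apply/funext => t; rewrite mxE.
Qed.

Lemma volterra_adjE m (a : R -> 'cV[R]_m) t i : integrable_sig 0 tf a ->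
  0 <= t <= tf -> volterra_adj a t i 0 = volterra a tf i 0 - volterra a t i 0.
Proof.
move=> ia /andP[t0 ttf]; rewrite !mxE.
rewrite (Rintegral_itvB (ia i)) ?bnd_simp// Rintegral_itv_obnd_cbnd//.
apply: integrableS (ia i) => //; apply: subset_itvr; by rewrite bnd_simp.
Qed.

Lemma volterra_adj_bounded_measurable m (a : R -> 'cV[R]_m) i :
  integrable_sig 0 tf a ->
  bounded_measurable `[0, tf] (fun t => volterra_adj a t i 0).
Proof.
move=> ia; have : bounded_measurable `[0, tf]
    (fun t => volterra a tf i 0 + (-1) * volterra a t i 0).
  apply: bounded_measurableD; first exact: bounded_measurable_cst.
  apply: bounded_measurableM; first exact: bounded_measurable_cst.
  exact/within_continuous_bounded_measurable/volterra_continuous.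
have E t : t \in (`[0, tf]%classic : set R) ->
    volterra a tf i 0 + (-1) * volterra a t i 0 = volterra_adj a t i 0.
  by rewrite inE/= in_itv/= => tI; rewrite volterra_adjE// mulN1r.
move=> [mW [M WM]]; split; first exact: eq_measurable_fun mW.
by exists M => t tI; rewrite -E ?inE//; exact: WM.
Qed.

Lemma L2_volterra m (a : R -> 'cV[R]_m) : L2 tf a -> L2 tf (volterra a).
Proof.
move=> a2; apply/L2P => i; apply: square_integrable_bounded.
by apply/within_continuous_bounded_measurable/volterra_continuous/L2_integrable_sig.
Qed.

Lemma L2_volterra_adj m (a : R -> 'cV[R]_m) : L2 tf a -> L2 tf (volterra_adj a).
Proof.
move=> a2; apply/L2P => i; apply: square_integrable_bounded.
by apply/volterra_adj_bounded_measurable/L2_integrable_sig.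
Qed.

(** The exchange of the order of integration on the triangle s <= t. *)
Lemma ip_volterra m (a b : R -> 'cV[R]_m) : L2 tf a -> L2 tf b ->
  ip tf (volterra a) b = ip tf a (volterra_adj b).
Proof.
move=> a2 b2; apply: eq_bigr => i _.
have ia : itg (fun t => a t i 0) by exact: (L2_integrable_sig (lexx 0) (lexx tf) a2).
have ib : itg (fun t => b t i 0) by exact: (L2_integrable_sig (lexx 0) (lexx tf) b2).
under eq_Rintegral do rewrite mxE mulrC.
rewrite Rintegral_triangle//; apply: eq_Rintegral => t _.
by rewrite [in RHS]mxE.
Qed.

Lemma integral_abs_le_L2norm m (i : 'I_m) : exists2 c, 0 <= c &
  forall a : R -> 'cV[R]_m, L2 tf a ->
    \int[mu]_(t in `[0, tf]) `|a t i 0| <= c * L2norm tf a.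
Proof.
pose e : R -> 'cV[R]_m := fun=> delta_mx i 0.
have e2 : L2 tf e.
  by apply/L2P => j; exact: square_integrable_cst.
exists (L2norm tf e); first exact: L2norm_ge0.
move=> a a2; pose b : R -> 'cV[R]_m := fun t => \col_j `|a t j 0|.
have b2 : L2 tf b.
  apply/L2P => j; have /L2P/(_ j)[ma ia] := a2; split.
    rewrite (_ : (fun t => _) = (fun t => `|a t j 0|)); first exact: measurableT_comp.
    by apply/funext => t; rewrite mxE.
  by under [X in integrable _ _ X]eq_fun do rewrite /= mxE real_normK ?num_real//.
have <- : L2norm tf b = L2norm tf a.
  congr Num.sqrt; apply: eq_Rintegral => t _; rewrite !enorm_sqr.
  by apply: eq_bigr => j _; rewrite mxE real_normK ?num_real.
rewrite mulrC; apply: le_trans (Cauchy_Schwarz b2 e2).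
rewrite /ip (bigD1 i)//= big1 ?addr0 => [|j ji].
  by under [leRHS]eq_Rintegral do rewrite !mxE !eqxx mulr1.
rewrite /Rintegral; under eq_integral do rewrite !mxE (negbTE ji) mulr0.
by rewrite integral0.
Qed.

(** On a bounded horizon, an operator that is bounded from L1 to the sup norm
    is bounded on L2. *)
Lemma bounded_op_sup m (K : (R -> 'cV[R]_m) -> R -> 'cV[R]_m) :
  (forall a, L2 tf a -> L2 tf (K a)) ->
  (forall a, L2 tf a -> forall t i, 0 <= t <= tf ->
     `|K a t i 0| <= \int[mu]_(s in `[0, tf]) `|a s i 0|) ->
  bounded_op tf K.
Proof.
move=> K2 Ka; split=> //.
have /choice[c hc] : forall i : 'I_m, exists c, 0 <= c /\ forall a : R -> 'cV[R]_m,
    L2 tf a -> \int[mu]_(t in `[0, tf]) `|a t i 0| <= c * L2norm tf a.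
  by move=> i; have [c c0 hc] := integral_abs_le_L2norm i; exists c.
pose d := \sum_i c i.
have d0 : 0 <= d by apply: sumr_ge0 => i _; have [] := hc i.
exists (Num.sqrt m%:R * (d * Num.sqrt tf)).
  by rewrite mulr_ge0 ?sqrtr_ge0// mulr_ge0// sqrtr_ge0.
move=> a a2; rewrite -mulrA; apply: L2norm_le_component => [||i].
- by rewrite mulr_ge0 ?L2norm_ge0// mulr_ge0// sqrtr_ge0.
- exact: K2.
have /L2P/(_ i)[_ iK] := K2 _ a2.
apply: (@le_trans _ _ (\int[mu]_(t in `[0, tf]) ((d * L2norm tf a) ^+ 2))).
  apply: le_Rintegral => //.
    by apply: square_integrable_integrable; exact: square_integrable_cst.
  move=> t; rewrite /= in_itv/= => tI.
  rewrite -[leLHS]real_normK ?num_real// ler_pXn2r ?nnegrE ?mulr_ge0 ?L2norm_ge0//.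
  apply: le_trans (Ka _ a2 t i tI) _; apply: le_trans ((hc i).2 _ a2) _.
  rewrite ler_wpM2r ?L2norm_ge0// /d (bigD1 i)//= lerDl.
  by apply: sumr_ge0 => j _; have [] := hc j.
rewrite Rintegral_cst//= lebesgue_measure_itv/= lte_fin htf/= subr0.
rewrite le_eqVlt; apply/orP; left; apply/eqP.
have := sqr_sqrtr (ltW htf).
move: (Num.sqrt tf) (L2norm tf a) => x y <-; ring.
Qed.

Lemma ler_norm_Rintegral_sub (f : R -> R) s t : 0 <= s -> t <= tf -> itg f ->
  `|\int[mu]_(r in `[s, t]) f r| <= \int[mu]_(r in `[0, tf]) `|f r|.
Proof.
move=> s0 ttf fi; have fist := integrable_subitv s0 ttf fi.
have nfi : itg (fun r => `|f r|) by exact: integrable_norm fi.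
have nfist := integrable_subitv s0 ttf nfi.
apply: le_trans (le_normr_Rintegral _ fist) _ => //.
rewrite -lee_fin !EFin_Rintegral//; apply: ge0_subset_integral => //.
  by case/integrableP : nfi.
by apply: subset_itvScc; rewrite bnd_simp.
Qed.

Lemma bounded_op_volterra m : bounded_op tf (@volterra m).
Proof.
apply: bounded_op_sup => [a|a a2 t i /andP[t0 ttf]]; first exact: L2_volterra.
rewrite mxE; apply: ler_norm_Rintegral_sub => //.
exact: (L2_integrable_sig (lexx 0) (lexx tf) a2).
Qed.

Lemma bounded_op_volterra_adj m : bounded_op tf (@volterra_adj m).
Proof.
apply: bounded_op_sup => [a|a a2 t i /andP[t0 ttf]]; first exact: L2_volterra_adj.
rewrite mxE; apply: ler_norm_Rintegral_sub => //.
exact: (L2_integrable_sig (lexx 0) (lexx tf) a2).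
Qed.

End VectorVolterra.

(** * The input-output map and its adjoint *)

Section SystemOperators.
Context (R : realType) (n m : nat) (tf : R) (htf : 0 < tf).
Context (A : 'M[R]_n) (B : 'M[R]_(n, m)) (C : 'M[R]_(m, n)) (D : 'M[R]_m).

Let CE t := C *m expmx (t *: A).
Let EB t := expmx ((- t) *: A) *m B.

Let bCE : bounded_measurable_mx tf CE.
Proof.
by apply: bounded_measurable_mx_mul;
  [exact: bounded_measurable_mx_cst|exact: bounded_measurable_mx_expmx].
Qed.

Let bEB : bounded_measurable_mx tf EB.
Proof.
by apply: bounded_measurable_mx_mul;
  [exact: bounded_measurable_mx_expmxN|exact: bounded_measurable_mx_cst].
Qed.

(** The kernel C exp((t - s) A) B separates as (C exp(t A)) (exp(- s A) B), so
    the input-output map is a running integral between two pointwise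
    multipliers. Its boundedness and its adjoint are read off the factors. *)
Definition Gfac (u : R -> 'cV[R]_m) : R -> 'cV[R]_m :=
  fun t => mulsig CE (volterra (mulsig EB u)) t + mulsig (fun=> D) u t.

(** The adjoints of the three factors of Gfac, in reverse order. *)
Definition Gadj (v : R -> 'cV[R]_m) : R -> 'cV[R]_m :=
  fun t => mulsig (fun s => (EB s)^T)
             (volterra_adj tf (mulsig (fun s => (CE s)^T) v)) t +
           mulsig (fun=> D^T) v t.

Lemma Gop_Gfac u : L2 tf u -> eq_on tf (Gop A B C D u) (Gfac u).
Proof.
move=> u2 t /andP[t0 ttf]; rewrite /Gop /Gfac /mulsig; congr (_ + _).
have EBu2 := L2_mulsig bEB u2.
rewrite -vint_mulmx; last exact: L2_integrable_sig EBu2.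
by apply: eq_vint => r _; rewrite expmxB /CE /mulsig /EB !mulmxA.
Qed.

Lemma bounded_op_Gfac : bounded_op tf Gfac.
Proof.
apply: bounded_opD; last first.
  exact/bounded_op_mulsig/bounded_measurable_mx_cst.
apply: (bounded_op_comp (K := mulsig CE)); first exact: bounded_op_mulsig.
apply: (bounded_op_comp (K := @volterra R n)); first exact: bounded_op_volterra.
exact: bounded_op_mulsig.
Qed.

Lemma bounded_op_Gop : bounded_op tf (Gop A B C D).
Proof.
by apply: bounded_op_eq_on bounded_op_Gfac => u u2 t tI; rewrite Gop_Gfac.
Qed.

Lemma bounded_op_Gadj : bounded_op tf Gadj.
Proof.
apply: bounded_opD; last first.
  exact/bounded_op_mulsig/bounded_measurable_mx_cst.
apply: (bounded_op_comp (K := mulsig (fun s => (EB s)^T))).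
  exact/bounded_op_mulsig/bounded_measurable_mx_tr.
apply: (bounded_op_comp (K := @volterra_adj R tf n)).
  exact: bounded_op_volterra_adj.
exact/bounded_op_mulsig/bounded_measurable_mx_tr.
Qed.

Lemma ip_Gop u v : L2 tf u -> L2 tf v ->
  ip tf (Gop A B C D u) v = ip tf u (Gadj v).
Proof.
move=> u2 v2.
have bD := bounded_measurable_mx_cst tf D.
have EBu2 := L2_mulsig bEB u2.
have Va2 := L2_volterra htf EBu2.
have CEv2 := L2_mulsig (bounded_measurable_mx_tr bCE) v2.
have Vb2 := L2_volterra_adj htf CEv2.
rewrite (ip_eq_on (Gop_Gfac u2) (fun t _ => erefl (v t))).
have EBVb2 := L2_mulsig (bounded_measurable_mx_tr bEB) Vb2.
have Dv2 := L2_mulsig (bounded_measurable_mx_tr bD) v2.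
rewrite (ipDl (L2_mulsig bCE Va2) (L2_mulsig bD u2) v2) (ip_mulsig bCE Va2 v2).
rewrite (ip_volterra EBu2 CEv2) (ip_mulsig bEB u2 Vb2) (ip_mulsig bD u2 v2).
by rewrite -(ipDr EBVb2 Dv2 u2).
Qed.

Lemma Gop_linear c u v : L2 tf u -> L2 tf v ->
  eq_on tf (Gop A B C D (fun t => c *: u t + v t))
           (fun t => c *: Gop A B C D u t + Gop A B C D v t).
Proof.
move=> u2 v2 t tI; have /andP[t0 ttf] := tI.
rewrite (Gop_Gfac (L2D (L2Z c u2) v2) tI) (Gop_Gfac u2 tI) (Gop_Gfac v2 tI).
have iu := L2_integrable_sig (lexx 0) ttf (L2_mulsig bEB u2).
have iv := L2_integrable_sig (lexx 0) ttf (L2_mulsig bEB v2).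
have icu := L2_integrable_sig (lexx 0) ttf (L2Z c (L2_mulsig bEB u2)).
rewrite /Gfac /mulsig /volterra.
rewrite (_ : (fun s => EB s *m (c *: u s + v s)) =
             (fun s => c *: (EB s *m u s) + EB s *m v s)); last first.
  by apply/funext => s; rewrite mulmxDr -scalemxAr.
rewrite vintD// vintZ// !mulmxDr -!scalemxAr scalerDr.
by rewrite !addrA; congr (_ + _); rewrite -!addrA; congr (_ + _); rewrite addrC.
Qed.

Section Feedback.
Context (Sig Q Rw : 'M[R]_m).
Context (hSig : signature_mx Sig) (hsym : externally_symmetric A B C D Sig).

Lemma signature_sym : Sig^T = Sig.
Proof.
have [/is_diag_mxP S _] := hSig; apply/matrixP => i j; rewrite mxE.
by have [->//|ij] := eqVneq i j; rewrite !S// eq_sym.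
Qed.

Lemma signature_sqr : Sig *m Sig = 1%:M.
Proof.
have [/is_diag_mxP S S1] := hSig; apply/matrixP => i j.
rewrite mxE (bigD1 i)//= big1 ?addr0 => [|k ki]; last by rewrite S ?mul0r// eq_sym.
rewrite mxE; have [<-|ij] := eqVneq i j; last by rewrite (S i j)// mulr0.
by have [->|->] := S1 i; rewrite ?mulr1// mulrNN mulr1.
Qed.

(** External symmetry: Sig conjugates the impulse response into its transpose,
    so time reversal and Sig turn the input-output map into its adjoint. *)
Lemma feedback_Gadj y : L2 tf y ->
  eq_on tf (feedback A B C D Sig Q Rw tf y)
           (fun t => - (invmx Rw *m Gadj (fun s => Q *m y s) t)).
Proof.
move=> y2 t /andP[t0 ttf].
have Qy2 : L2 tf (fun s => Q *m y s).
  exact: (L2_mulsig (bounded_measurable_mx_cst tf Q) y2).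
have [SD _] := external_symmetry_markov hsym.
have SS := signature_sqr; have St := signature_sym.
have SDS : Sig *m D *m Sig = D^T by rewrite -mulmxA -SD mulmxA SS mul1mx.
rewrite /feedback /mxact /reversal /Gop mulNmx -(mulmxA (invmx Rw)); congr (- (_ *m _)).
rewrite mulmxDr subKr /Gadj /mulsig; congr (_ + _); last first.
  by rewrite !mulmxA SDS.
have ib : integrable_sig t tf (fun s => (CE s)^T *m (Q *m y s)).
  apply: (L2_integrable_sig t0 (lexx tf)).
  exact: (L2_mulsig (bounded_measurable_mx_tr bCE) Qy2).
(* The integrand of J G Sig Q J at time t, after the substitution s = tf - r. *)
pose F s := C *m expmx ((s - t) *: A) *m B *m (Sig *m Q *m y s).
have SF s : F s = Sig *m (EB t)^T *m ((CE s)^T *m (Q *m y s)).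
  rewrite /F; have /(congr1 (mulmx Sig)) := impulse_response_symmetric (s - t) hsym St.
  rewrite mulmxA SS mul1mx => e.
  rewrite -!mulmxA !(mulmxA (EB t)^T) -trmx_mul.
  rewrite (_ : CE s *m EB t = C *m expmx ((s - t) *: A) *m B); last first.
    by rewrite expmxB /CE /EB !mulmxA.
  by rewrite e !mulmxA SS mul1mx.
have mF i : measurable_fun `[t, tf] (fun s => F s i 0).
  rewrite (_ : (fun s => _) = (fun s => \sum_k (Sig *m (EB t)^T) i k *
     ((CE s)^T *m (Q *m y s)) k 0)); last by apply/funext => s; rewrite SF mxE.
  apply: measurable_sum => k; apply: measurable_funM => //.
  by apply/measurable_EFinP; have /integrableP[] := ib k.
have -> : vint 0 (tf - t) (fun r => C *m expmx ((tf - t - r) *: A) *m B *m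
    (Sig *m Q *m y (tf - r))) = vint t tf F.
  apply/matrixP => i j; rewrite (ord1 j) !mxE -(Rintegral_reflection (mF i)).
  by apply: eq_Rintegral => r _; rewrite /F addrAC.
rewrite (eq_vint (b := fun s => Sig *m (EB t)^T *m ((CE s)^T *m (Q *m y s)))); last first.
  by move=> s _; exact: SF.
by rewrite vint_mulmx// !mulmxA SS mul1mx.
Qed.

End Feedback.
End SystemOperators.

Lemma Gadj_linear (R : realType) (n m : nat) (tf : R) (A : 'M[R]_n)
    (B : 'M[R]_(n, m)) (C : 'M[R]_(m, n)) (D : 'M[R]_m) (c : R)
    (u v : R -> 'cV[R]_m) : L2 tf u -> L2 tf v ->
  eq_on tf (Gadj tf A B C D (fun t => c *: u t + v t))
           (fun t => c *: Gadj tf A B C D u t + Gadj tf A B C D v t).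
Proof.
move=> u2 v2 t tI; have /andP[t0 ttf] := tI.
have bCE : bounded_measurable_mx tf (fun s => (C *m expmx (s *: A))^T).
  apply/bounded_measurable_mx_tr/bounded_measurable_mx_mul.
    exact: bounded_measurable_mx_cst.
  exact: bounded_measurable_mx_expmx.
have iu := L2_integrable_sig t0 (lexx tf) (L2_mulsig bCE u2).
have iv := L2_integrable_sig t0 (lexx tf) (L2_mulsig bCE v2).
have icu := L2_integrable_sig t0 (lexx tf) (L2Z c (L2_mulsig bCE u2)).
rewrite /Gadj /mulsig /volterra_adj.
rewrite (_ : (fun s => (C *m expmx (s *: A))^T *m (c *: u s + v s)) =
  (fun s => c *: ((C *m expmx (s *: A))^T *m u s) +
            (C *m expmx (s *: A))^T *m v s)); last first.
  by apply/funext => s; rewrite mulmxDr -scalemxAr.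
rewrite vintD// vintZ// !mulmxDr -!scalemxAr scalerDr.
by rewrite !addrA; congr (_ + _); rewrite -!addrA; congr (_ + _); rewrite addrC.
Qed.

(** * State trajectories *)

Section StateEquation.
Context (R : realType) (tf : R) (htf : 0 < tf).
Notation mu := (@lebesgue_measure R).
Notation itg f := (mu.-integrable `[0, tf] (EFin \o f)).

Lemma volterra_by_parts_cst (p p1 a : R -> R) (c t : R) :
  (forall x, is_derive x (1 : R) p (p1 x)) -> continuous p1 -> itg a ->
  0 <= t <= tf ->
  p t * (c + \int[mu]_(s in `[0, t]) a s) =
  p 0 * c + \int[mu]_(s in `[0, t])
    (p1 s * (c + \int[mu]_(r in `[0, s]) a r) + p s * a s).
Proof.
move=> dp cp1 ia tI; have /andP[t0 ttf] := tI.
have iat := integrable_subitv (lexx 0) ttf ia.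
have cp : continuous p.
  move=> x; apply: differentiable_continuous; apply/derivable1_diffP.
  by have [] := dp x.
have bp1 := continuous_bounded_measurable 0 t cp1.
have bp := continuous_bounded_measurable 0 t cp.
have bV : bounded_measurable `[0, t] (fun s => \int[mu]_(r in `[0, s]) a r).
  apply: within_continuous_bounded_measurable.
  exact: (parameterized_integral_continuous t0 iat).
rewrite mulrDr (volterra_by_parts dp cp1 ia tI).
under [in RHS]eq_Rintegral do rewrite mulrDr -addrA.
rewrite [in RHS]RintegralD//; last 2 first.
- apply: bounded_measurable_integrable; apply: bounded_measurableM => //.
  exact: bounded_measurable_cst.
- apply: integrable_addr => //.
    by apply: bounded_measurable_integrable; exact: bounded_measurableM.
  exact: bounded_measurable_mul_integrable.
rewrite RintegralZr//; last exact: bounded_measurable_integrable.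
by rewrite (Rintegral_derivative t0 dp cp1); ring.
Qed.

(** Integration by parts M w = M(0) w0 + int (M' w + M a) for an absolutely
    continuous curve w with derivative a and a smooth matrix function M. *)
Lemma mulmx_by_parts p q (M M' : R -> 'M[R]_(p, q)) (a : R -> 'cV[R]_q)
    (w0 : 'cV[R]_q) (t : R) :
  (forall s i j, is_derive s (1 : R) (fun r => M r i j) (M' s i j)) ->
  (forall i j, continuous (fun r => M' r i j)) ->
  L2 tf a -> 0 <= t <= tf ->
  M t *m (w0 + volterra a t) =
  M 0 *m w0 + vint 0 t (fun s => M' s *m (w0 + volterra a s) + M s *m a s).
Proof.
move=> dM cM' a2 tI; have /andP[t0 ttf] := tI.
have ia := L2_integrable_sig (lexx 0) (lexx tf) a2.
have iat := L2_integrable_sig (lexx 0) ttf a2.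
apply/matrixP => i j; rewrite (ord1 j) {j} [LHS]mxE [RHS]mxE.
pose h k s := M' s i k * (w0 k 0 + \int[mu]_(r in `[0, s]) a r k 0) + M s i k * a s k 0.
have ih k : mu.-integrable `[0, t] (EFin \o h k).
  apply: integrable_addr => //.
    apply: bounded_measurable_integrable; apply: bounded_measurableM.
      exact: continuous_bounded_measurable.
    apply: bounded_measurableD; first exact: bounded_measurable_cst.
    apply: within_continuous_bounded_measurable.
    exact: (parameterized_integral_continuous t0 (iat k)).
  apply: bounded_measurable_mul_integrable => //.
  apply: continuous_bounded_measurable => x.
  apply: differentiable_continuous; apply/derivable1_diffP.
  by have [] := dM x i k.
have -> : (M 0 *m w0) i 0 = \sum_k M 0 i k * w0 k 0 by rewrite mxE.
have -> : vint 0 t (fun s => M' s *m (w0 + volterra a s) + M s *m a s) i 0 =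
    \sum_k \int[mu]_(s in `[0, t]) h k s.
  rewrite mxE -Rintegral_sum//; apply: eq_Rintegral => s _.
  rewrite !mxE -big_split/=; apply: eq_bigr => k _.
  by rewrite !mxE.
rewrite -big_split/=; apply: eq_bigr => k _; rewrite !mxE.
by rewrite (volterra_by_parts_cst (w0 k 0) (fun s => dM s i k) (cM' i k) (ia k) tI).
Qed.

Section State.
Context (n m : nat) (A : 'M[R]_n) (B : 'M[R]_(n, m)).
Implicit Types (u : R -> 'cV[R]_m).

Let EB t := expmx ((- t) *: A) *m B.

Let bEB : bounded_measurable_mx tf EB.
Proof.
by apply: bounded_measurable_mx_mul;
  [exact: bounded_measurable_mx_expmxN|exact: bounded_measurable_mx_cst].
Qed.

(** Variation of constants. *)
Definition state (x0 : 'cV[R]_n) u : R -> 'cV[R]_n :=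
  fun t => expmx (t *: A) *m (x0 + volterra (mulsig EB u) t).

Lemma state_is_state (x0 : 'cV[R]_n) u : L2 tf u -> is_state A B tf x0 u (state x0 u).
Proof.
move=> u2; have EBu2 := L2_mulsig bEB u2.
have iEBu := L2_integrable_sig (lexx 0) (lexx tf) EBu2.
split=> [i|t tI].
  rewrite (_ : (fun t => _) = (fun t => \sum_k expmx (t *: A) i k *
      (x0 k 0 + volterra (mulsig EB u) t k 0))); last first.
    by apply/funext => t; rewrite mxE; apply: eq_bigr => k _; congr (_ * _); rewrite mxE.
  move=> x; apply: cvgr_sum => k; apply: cvgM.
    exact: (continuous_subspaceT (@continuous_expmx R n A i k)).
  by apply: cvgD; [exact: cvg_cst|exact: volterra_continuous].
have cM' i j : continuous (fun r : R => (A *m expmx (r *: A)) i j).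
  rewrite (_ : (fun r => _) = (fun r => \sum_k A i k * expmx (r *: A) k j)).
    move=> x; apply: cvgr_sum => k; apply: cvgM; first exact: cvg_cst.
    exact: continuous_expmx.
  by apply/funext => r; rewrite mxE.
have := mulmx_by_parts (M := fun s => expmx (s *: A)) x0
  (is_derive_expmx A) cM' EBu2 tI.
rewrite expmx0 mul1mx => wE; rewrite {1}/state wE.
congr (_ + _); apply: eq_vint => s _.
by rewrite /state -mulmxA; congr (_ + _); rewrite /mulsig /EB !mulmxA expmxKN mul1mx.
Qed.

(** Multiplying the integral equation by exp(-t A) removes the unknown from
    the right-hand side, which gives uniqueness. *)
Lemma is_state_unique (x0 : 'cV[R]_n) u x : L2 tf u -> is_state A B tf x0 u x ->
  eq_on tf x (state x0 u).
Proof.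
move=> u2 [cx xE] t tI; have /andP[t0 ttf] := tI.
have x2 : L2 tf x.
  apply/L2P => i; apply: square_integrable_bounded.
  exact: within_continuous_bounded_measurable.
pose g s := A *m x s + B *m u s.
have g2 : L2 tf g.
  apply: L2D; [exact: (L2_mulsig (bounded_measurable_mx_cst tf A) x2)|
               exact: (L2_mulsig (bounded_measurable_mx_cst tf B) u2)].
have cM' i j : continuous (fun r : R => (- (A *m expmx ((- r) *: A))) i j).
  rewrite (_ : (fun r => _) = (fun r => - \sum_k A i k * expmx ((- r) *: A) k j)).
    move=> z; apply: cvgN; apply: cvgr_sum => k; apply: cvgM; first exact: cvg_cst.
    exact: continuous_expmxN.
  by apply/funext => r; rewrite mxE; congr (- _); rewrite mxE.
have := mulmx_by_parts (M := fun s => expmx ((- s) *: A)) x0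
  (is_derive_expmxN A) cM' g2 tI.
rewrite oppr0 expmx0 mul1mx (eq_vint (b := mulsig EB u)); last first.
  move=> s /andP[s0 st]; have sI : 0 <= s <= tf by rewrite s0 (le_trans st ttf).
  rewrite (_ : x0 + _ = x s); last by rewrite xE.
  by rewrite /g mulmxDr addrA mulNmx expmx_comm -mulmxA addNr add0r /mulsig /EB mulmxA.
rewrite (_ : x0 + volterra g t = x t); last by rewrite xE.
by rewrite /state /volterra => <-; rewrite mulmxA expmxKN mul1mx.
Qed.

End State.
End StateEquation.

(** * Constant weights and the induced norm *)

Section ConstantMatrices.
Context (R : realType) (tf : R) (m : nat).
Implicit Types (M S : 'M[R]_m) (u v : R -> 'cV[R]_m).

Lemma posdef_unitmx M : posdef M -> M \in unitmx.
Proof.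
move=> [_ Mpos]; rewrite -row_free_unit -kermx_eq0; apply/eqP/row_matrixP => i.
rewrite row0; apply/eqP; apply: contraT => v0.
have := Mpos (row i (kermx M))^T; rewrite trmxK -row_mul mulmx_ker row0 mul0mx mxE ltxx.
by apply; apply: contra v0 => /eqP v0; rewrite -[X in X == 0]trmxK v0 trmx0.
Qed.

Lemma posdef_possemidef M : posdef M -> possemidef M.
Proof.
move=> [Ms Mpos]; split=> // v; have [->|/Mpos/ltW//] := eqVneq v 0.
by rewrite trmx0 !mul0mx mxE.
Qed.

Lemma L2_mulmx M u : L2 tf u -> L2 tf (fun t => M *m u t).
Proof. by move=> u2; exact: (L2_mulsig (bounded_measurable_mx_cst tf M) u2). Qed.

Lemma ip_mulmx M u v : L2 tf u -> L2 tf v ->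
  ip tf (fun t => M *m u t) v = ip tf u (fun t => M^T *m v t).
Proof. by move=> u2 v2; exact: (ip_mulsig (bounded_measurable_mx_cst tf M) u2 v2). Qed.

Lemma bounded_op_mulmx M : bounded_op tf (fun u t => M *m u t).
Proof. exact: (bounded_op_mulsig (bounded_measurable_mx_cst tf M)). Qed.

Lemma quad_ge0 M u : possemidef M -> L2 tf u -> 0 <= ip tf u (fun t => M *m u t).
Proof.
move=> [_ Mpos] u2; rewrite ipE//; last exact: L2_mulmx.
by apply: Rintegral_ge0 => t _; rewrite mulmxA; exact: Mpos.
Qed.

Lemma quadD M u v : M^T = M -> L2 tf u -> L2 tf v ->
  ip tf (fun t => u t + v t) (fun t => M *m (u t + v t)) =
  ip tf u (fun t => M *m u t) + 2 * ip tf v (fun t => M *m u t) +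
  ip tf v (fun t => M *m v t).
Proof.
move=> Ms u2 v2; have Mu2 := L2_mulmx M u2; have Mv2 := L2_mulmx M v2.
rewrite (_ : (fun t => M *m (u t + v t)) = (fun t => M *m u t + M *m v t)); last first.
  by apply/funext => t; rewrite mulmxDr.
rewrite (ipDl u2 v2 (L2D Mu2 Mv2)) (ipDr Mu2 Mv2 u2) (ipDr Mu2 Mv2 v2).
have -> : ip tf u (fun t => M *m v t) = ip tf v (fun t => M *m u t).
  by rewrite -{1}Ms -(ip_mulmx M u2 v2) ipC.
ring.
Qed.

Lemma ip_norm0 u v : L2 tf u -> L2 tf v -> L2norm tf v = 0 -> ip tf u v = 0.
Proof.
move=> u2 v2 v0; have Nu2 := L2Z (-1) u2.
have := Cauchy_Schwarz u2 v2; have := Cauchy_Schwarz Nu2 v2.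
rewrite v0 !mulr0 (ipZl _ u2 v2); lra.
Qed.

Lemma L2norm_const0 : L2norm tf (fun=> 0 : 'cV[R]_m) = 0.
Proof.
have L20 : L2 tf (fun=> 0 : 'cV[R]_m).
  by apply/L2P => i; exact: square_integrable_cst.
have := L2normZ 0 L20; rewrite normr0 mul0r.
by under [X in L2norm _ X = _ -> _]eq_fun do rewrite scaler0.
Qed.

(** The induced norm bounds a bounded homogeneous operator; boundedness is what
    makes the supremum meaningful. *)
Lemma opnormP (K : (R -> 'cV[R]_m) -> R -> 'cV[R]_m) :
  bounded_op tf K ->
  (forall c u, L2 tf u -> eq_on tf (K (fun t => c *: u t)) (fun t => c *: K u t)) ->
  forall u, L2 tf u -> L2norm tf (K u) <= opnorm tf K * L2norm tf u.
Proof.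
move=> [K2 [c c0 Kc]] KZ u u2.
have [u0|u0] := eqVneq (L2norm tf u) 0.
  by rewrite u0 mulr0; have := Kc _ u2; rewrite u0 mulr0.
have up : 0 < L2norm tf u by rewrite lt_def u0 L2norm_ge0.
pose v t := (L2norm tf u)^-1 *: u t.
have v2 : L2 tf v by exact: L2Z.
have v1 : L2norm tf v = 1.
  by rewrite /v L2normZ// ger0_norm ?invr_ge0 ?L2norm_ge0// mulVf.
have Kv : L2norm tf (K v) = (L2norm tf u)^-1 * L2norm tf (K u).
  rewrite (L2norm_eq_on (KZ _ _ u2)) L2normZ; last exact: K2.
  by rewrite ger0_norm ?invr_ge0 ?L2norm_ge0.
rewrite -ler_pdivrMr// mulrC -Kv; apply: ub_le_sup.
  exists c => _ [w [w2 w1] <-]; apply: le_trans (Kc _ w2) _.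
  by rewrite -[leRHS]mulr1 ler_wpM2l.
by exists v => //; split => //=; rewrite v1.
Qed.

End ConstantMatrices.

Lemma L2norm_sqr_lincomb (R : realType) (tf : R) (m : nat) (a b : R)
    (u v : R -> 'cV[R]_m) : L2 tf u -> L2 tf v ->
  L2norm tf (fun t => a *: u t + b *: v t) ^+ 2 =
  a ^+ 2 * L2norm tf u ^+ 2 + 2 * (a * b) * ip tf u v + b ^+ 2 * L2norm tf v ^+ 2.
Proof.
move=> u2 v2; have au2 := L2Z a u2; have bv2 := L2Z b v2.
have w2 := L2D au2 bv2.
rewrite (L2norm_sqr w2) (L2norm_sqr u2) (L2norm_sqr v2) (ipDl au2 bv2 w2).
rewrite (ipDr au2 bv2 au2) (ipDr au2 bv2 bv2) (ipZl a u2 au2) (ipZl a u2 bv2).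
rewrite (ipZl b v2 au2) (ipZl b v2 bv2) (ipZr a u2 u2) (ipZr b u2 v2).
rewrite (ipZr a v2 u2) (ipZr b v2 v2) (ipC tf v u); ring.
Qed.
(** * The cost and the relaxed fixed-point iteration *)

Lemma scaled_squeeze_cvg0 (R : realType) (c : R) (r s : R^nat) :
  (forall k, 0 <= s k <= c * r k) -> r @ \oo --> (0 : R) -> s @ \oo --> (0 : R).
Proof.
move=> srk r0; apply: (squeeze_cvgr (nearW _ srk) (cvg_cst 0)).
by rewrite -[0 : R](mulr0 c); exact: cvgMr.
Qed.

Lemma shift_lincomb_cvg0 (R : realType) (q : R) (r : R^nat) :
  r @ \oo --> (0 : R) -> (fun k => q * r k + r k.+1) @ \oo --> (0 : R).
Proof.
move=> r0; rewrite -[0 : R](addr0 (0 : R)) -[X in X + _](mulr0 q).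
by apply: cvgD; [exact: cvgMr|move: r0; rewrite -cvg_shiftS].
Qed.

Section LinearQuadratic.
Context (R : realType) (n m : nat).
Context (A : 'M[R]_n) (B : 'M[R]_(n, m)) (C : 'M[R]_(m, n)) (D : 'M[R]_m).
Context (Sig Q Rw : 'M[R]_m) (tf : R) (x0 : 'cV[R]_n).
Context (htf : 0 < tf) (hSig : signature_mx Sig).
Context (hsym : externally_symmetric A B C D Sig).
Context (hQ : possemidef Q) (hR : posdef Rw).
Implicit Types (u v h w : R -> 'cV[R]_m).

Let G := Gop A B C D.
Let Gs := Gadj tf A B C D.
Let rootR := sqrtmx Rw.

Let Y u : R -> 'cV[R]_m := fun t => G u t + free_response A C x0 t.

Let rootR_psd : possemidef rootR.
Proof. by have [] := sqrtmxP (posdef_possemidef hR). Qed.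

Let rootR_sqr : rootR *m rootR = Rw.
Proof. by have [] := sqrtmxP (posdef_possemidef hR). Qed.

Let rootR_unit : rootR \in unitmx.
Proof. by have := posdef_unitmx hR; rewrite -rootR_sqr unitmx_mul andbb. Qed.

Let L2G u : L2 tf u -> L2 tf (G u).
Proof. by have [G2 _] := bounded_op_Gop htf A B C D; exact: G2. Qed.

Let L2Gs u : L2 tf u -> L2 tf (Gs u).
Proof. by have [G2 _] := bounded_op_Gadj htf A B C D; exact: G2. Qed.

Let L2free : L2 tf (free_response A C x0).
Proof.
have x02 : L2 tf (fun=> x0) by apply/L2P => i; exact: square_integrable_cst.
apply: (L2_mulsig _ x02); apply: bounded_measurable_mx_mul.
  exact: bounded_measurable_mx_cst.
exact: bounded_measurable_mx_expmx.
Qed.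

Let L2Y u : L2 tf u -> L2 tf (Y u).
Proof. by move=> u2; exact: (@L2D _ _ _ (G u) _ (L2G u2) L2free). Qed.

(** The cost picks its value along some state trajectory; every trajectory is
    the one given by variation of constants, so that value is the same for all
    of them. *)
Lemma cost_formula v : L2 tf v ->
  cost A B C D Q Rw tf x0 v = 2^-1 *
    (ip tf (Y v) (fun t => Q *m Y v t) + ip tf v (fun t => Rw *m v t)).
Proof.
move=> v2.
have along x : is_state A B tf x0 v x -> cost_along Q Rw tf (output C D x v) v =
    2^-1 * (ip tf (Y v) (fun t => Q *m Y v t) + ip tf v (fun t => Rw *m v t)).
  move=> /(is_state_unique v2) xE; congr (_ * _).
  have yE t : 0 <= t <= tf -> output C D x v t = Y v t.
    move=> tI; rewrite /output xE// /Y /G (Gop_Gfac A B C D v2)//.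
    by rewrite /Gfac /free_response /state /mulsig mulmxA mulmxDr -addrA addrC.
  have Y2 := L2Y v2; have QY2 := L2_mulmx Q Y2; have Rv2 := L2_mulmx Rw v2.
  have iY := integrable_dot Y2 QY2; have iv := integrable_dot v2 Rv2.
  rewrite (ipE Y2 QY2) (ipE v2 Rv2) -(RintegralD _ iY iv); last exact: measurable_itv.
  apply: eq_Rintegral => t; rewrite inE/= in_itv/= => tI.
  by rewrite (yE _ tI) !mulmxA.
rewrite /cost; set P := [set c | _].
have : P (xget 0 P).
  apply: xgetPex; exists (cost_along Q Rw tf (output C D (state A B x0 v) v) v).
  by exists (state A B x0 v) => //; exact: state_is_state.
by move=> [x xs ->]; exact: along.
Qed.

Let Sop_ := Sop A B C D Sig Q Rw tf.
Let Top_ := Top A B C D Sig Q Rw tf x0.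

Lemma TopE u : L2 tf u ->
  eq_on tf (Top_ u) (fun t => - (invmx Rw *m Gs (fun s => Q *m Y u s) t)).
Proof. by move=> u2; exact: (feedback_Gadj Q Rw hSig hsym (L2Y u2)). Qed.

Lemma SopE u : L2 tf u ->
  eq_on tf (Sop_ u) (fun t => - (invmx Rw *m Gs (fun s => Q *m G u s) t)).
Proof. by move=> u2; exact: (feedback_Gadj Q Rw hSig hsym (L2G u2)). Qed.

Let Sfac u : R -> 'cV[R]_m := fun t => - invmx Rw *m Gs (fun s => Q *m G u s) t.

Let bounded_op_Sop : bounded_op tf Sop_.
Proof.
apply: (@bounded_op_eq_on _ _ _ _ Sfac).
  by move=> u u2 t tI; rewrite SopE// /Sfac mulNmx.
apply: (bounded_op_comp (bounded_op_mulmx tf (- invmx Rw))).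
apply: (bounded_op_comp (K := Gs)); first exact: bounded_op_Gadj.
apply: (bounded_op_comp (bounded_op_mulmx tf Q)).
exact: bounded_op_Gop.
Qed.

Let L2Top u : L2 tf u -> L2 tf (Top_ u).
Proof.
move=> u2; have : L2 tf (fun t => - invmx Rw *m Gs (fun s => Q *m Y u s) t).
  by apply/L2_mulmx/L2Gs/L2_mulmx/L2Y.
by apply: L2_eq_on => t tI; rewrite TopE// mulNmx.
Qed.

(** T u = Fb (G u + d) and S u = Fb (G u), so linearity of Fb and G makes S
    the linear part of the affine map T. *)
Let Fb y : R -> 'cV[R]_m := fun t => - (invmx Rw *m Gs (fun s => Q *m y s) t).

Let Fb_linear c y z : L2 tf y -> L2 tf z ->
  eq_on tf (Fb (fun t => c *: y t + z t)) (fun t => c *: Fb y t + Fb z t).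
Proof.
move=> y2 z2 t tI; rewrite /Fb.
rewrite (_ : (fun s => Q *m (c *: y s + z s)) =
             (fun s => c *: (Q *m y s) + Q *m z s)); last first.
  by apply/funext => s; rewrite mulmxDr -scalemxAr.
have /= GE := Gadj_linear A B C D c (L2_mulmx Q y2) (L2_mulmx Q z2) tI.
by rewrite /Gs GE mulmxDr -scalemxAr opprD scalerN.
Qed.

Let Fb_eq_on y z : eq_on tf y z -> eq_on tf (Fb y) (Fb z).
Proof.
move=> yz t tI; rewrite /Fb; congr (- (_ *m _)).
rewrite /Gs /Gadj /mulsig /volterra_adj (yz _ tI).
apply: (congr1 (+%R^~ _)); apply: (congr1 (mulmx _)).
apply: eq_vint => r /andP[tr rtf]; rewrite (yz r)//.
by have /andP[t0 _] := tI; rewrite (le_trans t0 tr) rtf.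
Qed.

Lemma Sop_linear c u v : L2 tf u -> L2 tf v ->
  eq_on tf (Sop_ (fun t => c *: u t + v t)) (fun t => c *: Sop_ u t + Sop_ v t).
Proof.
move=> u2 v2 t tI; have cuv2 := L2D (L2Z c u2) v2.
rewrite !SopE//; rewrite -!/(Fb _ _).
rewrite (Fb_eq_on (Gop_linear A B C D c u2 v2) tI).
exact: (Fb_linear c (L2G u2) (L2G v2) tI).
Qed.

Lemma Sop_scale c u : L2 tf u ->
  eq_on tf (Sop_ (fun t => c *: u t)) (fun t => c *: Sop_ u t).
Proof.
move=> u2 t tI; have z2 : L2 tf (fun=> 0 : 'cV[R]_m).
  by apply/L2P => i; exact: square_integrable_cst.
have S0 : Sop_ (fun=> 0) t = 0.
  have := Sop_linear 1 z2 z2 tI.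
  rewrite (_ : (fun t => _ + _) = (fun=> 0 : 'cV[R]_m)); last first.
    by apply/funext => s; rewrite scaler0 addr0.
  by rewrite scale1r -{1}[Sop_ _ t]add0r => /addIr.
have := Sop_linear c u2 z2 tI; rewrite S0 addr0 => <-.
by congr (Sop_ _ t); apply/funext => s; rewrite addr0.
Qed.

Lemma Top_sub u v : L2 tf u -> L2 tf v ->
  eq_on tf (fun t => Top_ u t - Top_ v t) (Sop_ (fun t => u t - v t)).
Proof.
move=> u2 v2 t tI; have uv2 := L2B u2 v2.
rewrite !TopE// SopE// -!/(Fb _ _).
have GB : eq_on tf (Y u) (fun t => 1 *: G (fun t => u t - v t) t + Y v t).
  move=> s sI; rewrite scale1r /Y addrA; congr (_ + _).
  have := Gop_linear A B C D 1 uv2 v2 sI; rewrite scale1r => <-.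
  by congr (G _ s); apply/funext => r; rewrite scale1r subrK.
rewrite (Fb_eq_on GB tI) (Fb_linear 1 (L2G uv2) (L2Y v2) tI).
by rewrite scale1r addrK.
Qed.

Let rootR_invR : rootR *m invmx Rw = invmx rootR.
Proof.
apply: (can_inj (mulKmx rootR_unit)).
by rewrite mulmxA rootR_sqr mulmxV ?posdef_unitmx// mulmxV.
Qed.

(** The operator whose induced norm enters alphabar. *)
Let K w : R -> 'cV[R]_m := mxact rootR (Sop_ (mxact (invmx rootR) w)).

Let bounded_op_K : bounded_op tf K.
Proof.
apply: (bounded_op_comp (bounded_op_mulmx tf rootR)).
exact: (bounded_op_comp bounded_op_Sop (bounded_op_mulmx tf (invmx rootR))).
Qed.

Let K_scale c w : L2 tf w ->
  eq_on tf (K (fun t => c *: w t)) (fun t => c *: K w t).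
Proof.
move=> w2 t tI; rewrite /K /mxact.
have := Sop_scale c (L2_mulmx (invmx rootR) w2) tI.
rewrite (_ : (fun t => c *: (invmx rootR *m w t)) = (fun t => invmx rootR *m (c *: w t))).
  by move=> ->; rewrite -scalemxAr.
by apply/funext => s; rewrite -scalemxAr.
Qed.

(** K = - N* Q N with N = G R^-1/2: conjugation by the root of R symmetrizes
    R^-1 G* Q G. *)
Let K_neg w : L2 tf w -> ip tf w (K w) <= 0.
Proof.
move=> w2; have Sw2 := L2_mulmx (invmx rootR) w2.
have z2 := L2G Sw2; have Qz2 := L2_mulmx Q z2; have GQz2 := L2Gs Qz2.
have St : rootR^T = rootR := rootR_psd.1.
have KE : eq_on tf (K w)
    (fun t => (-1) *: (invmx rootR *m Gs (fun s => Q *m G (mxact (invmx rootR) w) s) t)).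
  move=> t tI; rewrite /K {1}/mxact (SopE Sw2 tI) scaleN1r mulmxN; congr (- _).
  by rewrite mulmxA rootR_invR.
have SGQz2 := L2_mulmx (invmx rootR) GQz2.
rewrite (ip_eq_on (fun t _ => erefl (w t)) KE) ipZr// mulN1r oppr_le0.
have -> : ip tf w (fun t => invmx rootR *m Gs (fun s => Q *m G (mxact (invmx rootR) w) s) t) =
    ip tf (mxact (invmx rootR) w) (Gs (fun s => Q *m G (mxact (invmx rootR) w) s)).
  by rewrite /mxact ip_mulmx// trmx_inv St.
have := quad_ge0 hQ z2; rewrite (ip_Gop htf A B C D Sw2 Qz2); exact.
Qed.

Let nu := opnorm tf K.

(** The gradient of the cost at v is R v + G* Q (G v + d) = R (v - T v). *)
Let gradient_ae0 v : L2 tf v -> sig_ae tf (Top_ v) v ->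
  L2norm tf (fun t => Gs (fun s => Q *m Y v s) t + Rw *m v t) = 0.
Proof.
move=> v2 Tv; have QY2 := L2_mulmx Q (L2Y v2).
have g2 := L2D (L2Gs QY2) (L2_mulmx Rw v2).
have z2 : L2 tf (fun=> 0 : 'cV[R]_m) by apply/L2P => i; exact: square_integrable_cst.
rewrite -(L2norm_const0 tf m).
apply: (L2norm_ae (L2_sig_measurable g2) (L2_sig_measurable z2)).
apply: ae_imply Tv => t Tv tI; have := Tv tI; rewrite (TopE v2 tI) => <-.
by rewrite mulmxN mulmxA mulmxV ?posdef_unitmx// mul1mx subrr.
Qed.

(** At a fixed point of T the gradient vanishes, so the quadratic cost exceeds
    its value there by its second-order part alone. *)
Let cost_excess v us : L2 tf us -> sig_ae tf (Top_ us) us -> L2 tf v ->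
  let h t := v t - us t in
  cost A B C D Q Rw tf x0 v = cost A B C D Q Rw tf x0 us +
    2^-1 * (ip tf (G h) (fun t => Q *m G h t) + ip tf h (fun t => Rw *m h t)).
Proof.
move=> us2 Tus v2 h; have h2 : L2 tf h := L2B v2 us2.
have Y2 := L2Y us2; have Gh2 := L2G h2.
have YE : eq_on tf (Y v) (fun t => Y us t + G h t).
  move=> t tI; have GE : G v t = G h t + G us t.
    have := Gop_linear A B C D 1 h2 us2 tI; rewrite scale1r => <-.
    by congr (G _ t); apply/funext => s; rewrite scale1r subrK.
  by rewrite /Y GE -addrA [RHS]addrC.
have vE : eq_on tf v (fun t => us t + h t) by move=> t _; rewrite addrC subrK.
rewrite (cost_formula v2) (cost_formula us2).
have -> : ip tf (Y v) (fun t => Q *m Y v t) =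
    ip tf (fun t => Y us t + G h t) (fun t => Q *m (Y us t + G h t)).
  by apply: (ip_eq_on YE) => t tI; rewrite (YE _ tI).
have -> : ip tf v (fun t => Rw *m v t) =
    ip tf (fun t => us t + h t) (fun t => Rw *m (us t + h t)).
  by apply: (ip_eq_on vE) => t tI; rewrite -(vE _ tI).
rewrite (quadD hQ.1 Y2 Gh2) (quadD hR.1 us2 h2).
have QY2 := L2_mulmx Q Y2; have Rus2 := L2_mulmx Rw us2.
have := ip_norm0 h2 (L2D (L2Gs QY2) Rus2) (gradient_ae0 us2 Tus).
rewrite (ipDr (L2Gs QY2) Rus2 h2) -(ip_Gop htf A B C D h2 QY2) -/G.
move: (ip _ _ _) (ip _ _ _) (ip _ _ _) (ip _ _ _) (ip _ _ _) (ip _ _ _) => *; lra.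
Qed.

Let ip_weight h : L2 tf h ->
  ip tf h (fun t => Rw *m h t) = L2norm tf (fun t => rootR *m h t) ^+ 2.
Proof.
move=> h2; have Sh2 := L2_mulmx rootR h2.
rewrite (L2norm_sqr Sh2) (ip_mulmx rootR h2 Sh2) rootR_psd.1.
by congr ip; apply/funext => t; rewrite mulmxA rootR_sqr.
Qed.

Let weighted_norm0_ae u v : L2 tf u -> L2 tf v ->
  L2norm tf (fun t => rootR *m (u t - v t)) = 0 -> sig_ae tf u v.
Proof.
move=> u2 v2 uv0; have uv2 := L2_mulmx rootR (L2B u2 v2).
apply: ae_imply (L2norm0_ae uv2 uv0) => t uv tI; apply/eqP; rewrite -subr_eq0.
by rewrite -[_ - _](mulKmx rootR_unit) uv// mulmx0.
Qed.

Lemma fixed_point_optimal us : L2 tf us -> sig_ae tf (Top_ us) us ->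
  optimal A B C D Q Rw tf x0 us /\
  forall v, optimal A B C D Q Rw tf x0 v -> sig_ae tf v us.
Proof.
move=> us2 Tus; have excess_ge0 v : L2 tf v ->
    0 <= ip tf (G (fun t => v t - us t)) (fun t => Q *m G (fun t => v t - us t) t).
  by move=> v2; exact: (quad_ge0 hQ (L2G (L2B v2 us2))).
split=> [|v [v2 vmin]].
  split=> // v v2; rewrite (cost_excess us2 Tus v2) (ip_weight (L2B v2 us2)).
  by rewrite lerDl mulr_ge0// addr_ge0 ?sqr_ge0 ?excess_ge0.
apply: (weighted_norm0_ae v2 us2); apply/eqP; rewrite -sqrf_eq0.
have := vmin _ us2; rewrite (cost_excess us2 Tus v2) (ip_weight (L2B v2 us2)).
have := excess_ge0 _ v2; rewrite eq_le sqr_ge0 andbT.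
move: (ip _ _ _) (_ ^+ 2) (cost _ _ _ _ _ _ _ _ _) => *; lra.
Qed.

Section Iteration.
Context (alpha : R)
  (halpha : 0 < alpha < Num.min (alphabar A B C D Sig Q Rw tf) 1).

Let a0 : 0 < alpha. Proof. by case/andP: halpha. Qed.

Let a1 : alpha < 1.
Proof. by case/andP: halpha => _; rewrite lt_min => /andP[]. Qed.

Let q2 := (1 - alpha) ^+ 2 + alpha ^+ 2 * nu ^+ 2.

(** (1 - alpha)^2 + alpha^2 nu^2 = 1 - alpha (2 - alpha (nu^2 + 1)), and the
    last factor is positive exactly when alpha < alphabar. *)
Let q2_lt1 : 0 < q2 < 1.
Proof.
have n0 := sqr_ge0 nu.
case/andP: halpha => _; rewrite lt_min => /andP[+ _].
rewrite -[alphabar _ _ _ _ _ _ _ _]/(2 / (nu ^+ 2 + 1)).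
rewrite ltr_pdivlMr; last by lra.
move=> h; have a0' := a0; have a1' := a1; apply/andP; split; rewrite /q2.
  by apply: ltr_pwDl; [rewrite exprn_gt0// subr_gt0|rewrite mulr_ge0 ?sqr_ge0].
have : 0 < alpha * (2 - alpha * (nu ^+ 2 + 1)) by rewrite mulr_gt0// subr_gt0.
by move: (nu ^+ 2) => x; nra.
Qed.

Let q := Num.sqrt q2.

Let q01 : 0 < q < 1.
Proof.
have /andP[q0 q1] := q2_lt1; rewrite sqrtr_gt0 q0/=.
by rewrite -sqrtr1 ltr_sqrt// ltr01.
Qed.

Let relax e : R -> 'cV[R]_m := fun t => (1 - alpha) *: e t + alpha *: Sop_ e t.

(** In the norm of R^1/2 e the relaxed operator becomes (1 - alpha) + alpha K.
    Expanding the square of (1 - alpha) w + alpha K w, the cross term is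
    nonpositive because K is negative semidefinite and 0 < alpha < 1; what
    remains is at most q2 times the square of the norm of w. *)
Let relax_contract e : L2 tf e ->
  L2norm tf (fun t => rootR *m relax e t) <= q * L2norm tf (fun t => rootR *m e t).
Proof.
move=> e2; pose w t := rootR *m e t; have w2 : L2 tf w := L2_mulmx rootR e2.
have [K2 _] := bounded_op_K; have Kw2 := K2 _ w2.
have wE : (fun t => rootR *m relax e t) =
    (fun t => (1 - alpha) *: w t + alpha *: K w t).
  apply/funext => t; rewrite /relax mulmxDr -!scalemxAr; congr (_ + _ *: _).
  rewrite /K /mxact; congr (_ *m Sop_ _ t).
  by apply/funext => s; rewrite /w mulKmx.
rewrite wE.
rewrite -(ler_pXn2r (n := 2)) ?nnegrE ?L2norm_ge0//; last first.
  by rewrite mulr_ge0 ?L2norm_ge0// sqrtr_ge0.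
have qq : q ^+ 2 = q2 by rewrite sqr_sqrtr//; have /andP[/ltW] := q2_lt1.
rewrite exprMn qq (L2norm_sqr_lincomb _ _ w2 Kw2).
have := K_neg w2; have := opnormP bounded_op_K K_scale w2; rewrite -/nu.
have := L2norm_ge0 tf (K w); have := L2norm_ge0 tf w; have := a0; have := a1.
rewrite /q2; move: (ip tf w (K w)) (L2norm tf (K w)) (L2norm tf w) => c k x.
move=> h1 h0 x0' k0 kx c0.
have k2 : k ^+ 2 <= nu ^+ 2 * x ^+ 2 by rewrite -exprMn ler_pXn2r ?nnegrE// (le_trans k0).
have ac : alpha * (1 - alpha) * c <= 0.
  by rewrite mulr_ge0_le0// mulr_ge0// ?subr_ge0; exact: ltW.
have : alpha ^+ 2 * k ^+ 2 <= alpha ^+ 2 * (nu ^+ 2 * x ^+ 2).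
  by rewrite ler_wpM2l// sqr_ge0.
lra.
Qed.

Let step u := relaxed_step A B C D Sig Q Rw tf x0 alpha u.

Lemma L2_relaxed_step u : L2 tf u -> L2 tf (step u).
Proof. by move=> u2; exact: (L2D (L2Z _ u2) (L2Z _ (L2Top u2))). Qed.

Let weighted_norm u v := L2norm tf (fun t => rootR *m (u t - v t)).

Let weighted_normC u v : L2 tf u -> L2 tf v -> weighted_norm u v = weighted_norm v u.
Proof.
move=> u2 v2; rewrite -[RHS]mul1r -(normrN1 R) -(L2normZ _ (L2_mulmx rootR (L2B v2 u2))).
by apply: L2norm_eq_on => t _; rewrite scaleN1r -mulmxN opprB.
Qed.

Let step_contract u v : L2 tf u -> L2 tf v ->
  weighted_norm (step u) (step v) <= q * weighted_norm u v.
Proof.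
move=> u2 v2; apply: le_trans (relax_contract (L2B u2 v2)).
rewrite le_eqVlt; apply/orP; left; apply/eqP/L2norm_eq_on => t tI.
rewrite /step /relaxed_step /relax -(Top_sub u2 v2 tI) !scalerBr.
by rewrite opprD addrACA.
Qed.

Context (u : nat -> R -> 'cV[R]_m) (u2 : forall k, L2 tf (u k))
  (ustep : forall k, sig_ae tf (u k.+1) (step (u k))).

Let weighted_increment k :
  weighted_norm (u k.+1) (u k) <= weighted_norm (u 1%N) (u 0%N) * q ^+ k.
Proof.
elim: k => [|k IHk]; first by rewrite expr0 mulr1.
have q0 : 0 <= q by have /andP[/ltW] := q01.
rewrite exprSr mulrA mulrC; apply: le_trans (ler_wpM2l q0 IHk).
apply: le_trans (step_contract (u2 k.+1) (u2 k)).
rewrite le_eqVlt; apply/orP; left; apply/eqP.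
have uu2 := L2_mulmx rootR (L2B (u2 k.+2) (u2 k.+1)).
have ss2 := L2_mulmx rootR (L2B (L2_relaxed_step (u2 k.+1)) (L2_relaxed_step (u2 k))).
apply: (L2norm_ae (L2_sig_measurable uu2) (L2_sig_measurable ss2)).
by apply: ae_imply2 (ustep k.+1) (ustep k) => t e1 e0 tI; rewrite e1// e0.
Qed.

(** The weighted iterates R^1/2 u_k have geometrically decreasing increments,
    hence a limit R^1/2 us. Since u_(k+1) is within q |u_k - us| of the relaxed
    step from us in the weighted norm, that step leaves us fixed, and then so
    does T because alpha is nonzero. *)
Lemma relaxation_cvg_fixed_point : exists us : R -> 'cV[R]_m,
  [/\ L2 tf us, sig_ae tf (Top_ us) us
    & (fun k => L2norm tf (fun t => u k t - us t)) @ \oo --> (0 : R)].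
Proof.
have Su2 k := L2_mulmx rootR (u2 k).
have incr k : L2norm tf (fun t => rootR *m u k.+1 t - rootR *m u k t) <=
    weighted_norm (u 1%N) (u 0%N) * q ^+ k.
  apply: le_trans (weighted_increment k); rewrite le_eqVlt; apply/orP; left.
  by apply/eqP/L2norm_eq_on => t _; rewrite mulmxBr.
have [w w2 uw] := L2_complete htf q01 Su2 incr.
pose us t := invmx rootR *m w t; have us2 : L2 tf us := L2_mulmx _ w2.
have Sus t : rootR *m us t = w t by rewrite mulKVmx.
have r0 : (fun k => weighted_norm (u k) us) @ \oo --> (0 : R).
  apply: cvg_trans uw; apply: near_eq_cvg; apply: nearW => k.
  by apply: L2norm_eq_on => t _; rewrite mulmxBr Sus.
exists us; split; first exact: us2.
  have res_le k : weighted_norm (step us) us <=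
      q * weighted_norm (u k) us + weighted_norm (u k.+1) us.
    rewrite (weighted_normC (u2 k) us2).
    apply: le_trans (lerD (step_contract us2 (u2 k)) (lexx _)).
    have a2 := L2_mulmx rootR (L2B (L2_relaxed_step us2) (L2_relaxed_step (u2 k))).
    have b2 := L2_mulmx rootR (L2B (u2 k.+1) us2).
    have c2 := L2_mulmx rootR (L2B (L2_relaxed_step us2) us2).
    apply: le_trans (ler_L2normD a2 b2); rewrite le_eqVlt; apply/orP; left; apply/eqP.
    apply: (L2norm_ae (L2_sig_measurable c2) (L2_sig_measurable (L2D a2 b2))).
    by apply: ae_imply (ustep k) => t e tI; rewrite e// -mulmxDr addrA subrK.
  have res0 : weighted_norm (step us) us = 0.
    apply/eqP; rewrite eq_le L2norm_ge0 andbT.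
    by apply: (cvgr_to_ge (shift_lincomb_cvg0 q r0)); apply: nearW.
  apply: ae_imply (weighted_norm0_ae (L2_relaxed_step us2) us2 res0) => t e tI.
  have /eqP := e tI; rewrite /step /relaxed_step -subr_eq0 scalerBl scale1r.
  rewrite addrAC [_ - us t]addrAC subrr add0r addrC -scalerBr.
  by rewrite scaler_eq0 gt_eqF// subr_eq0 => /eqP.
have [_ [c c0 hc]] := bounded_op_mulmx tf (invmx rootR).
apply: (scaled_squeeze_cvg0 (c := c) _ r0) => k; rewrite L2norm_ge0/=.
have := hc _ (L2_mulmx rootR (L2B (u2 k) us2)).
rewrite (_ : (fun t => invmx rootR *m (rootR *m (u k t - us t))) = (fun t => u k t - us t))//.
by apply/funext => t; rewrite mulKmx.
Qed.

End Iteration.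

End LinearQuadratic.

Theorem theorem1 (R : realType) (n m : nat)
    (A : 'M[R]_n) (B : 'M[R]_(n, m)) (C : 'M[R]_(m, n)) (D : 'M[R]_m)
    (Sig Q Rw : 'M[R]_m) (tf : R) (x0 : 'cV[R]_n) (u0 : R -> 'cV[R]_m)
    (alpha : R) (u : nat -> R -> 'cV[R]_m)
    (hSig : signature_mx Sig)
    (hsym : externally_symmetric A B C D Sig)
    (hQ : possemidef Q)
    (hR : posdef Rw)
    (htf : 0 < tf)
    (hu0 : L2 tf u0)
    (halpha : 0 < alpha < Num.min (alphabar A B C D Sig Q Rw tf) 1)
    (hmeas : forall k, sig_measurable tf (u k))
    (hinit : sig_ae tf (u 0%N) u0)
    (hstep : forall k,
       sig_ae tf (u k.+1) (relaxed_step A B C D Sig Q Rw tf x0 alpha (u k))) :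
  exists ustar : R -> 'cV[R]_m,
    [/\ optimal A B C D Q Rw tf x0 ustar,
        forall v : R -> 'cV[R]_m,
          optimal A B C D Q Rw tf x0 v -> sig_ae tf v ustar
      & cvg_L2 tf u ustar].
Proof.
have u2 k : L2 tf (u k).
  elim: k => [|k u2]; first exact: L2_ae hu0 (hmeas 0%N) hinit.
  apply: (L2_ae _ (hmeas k.+1) (hstep k)).
  exact: (L2_relaxed_step Q Rw x0 htf hSig hsym alpha u2).
have [us [us2 Tus uus]] := relaxation_cvg_fixed_point htf hSig hsym hQ hR halpha u2 hstep.
have [usmin usuniq] := fixed_point_optimal htf hSig hsym hQ hR us2 Tus.
by exists us; split.
Qed.
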